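(* Let $H$ be a Hilbert module over a $C^*$-algebra. For every projection $P\in\mathcal{L}(H)$ and every idempotent $Q\in\mathcal{L}(H)$ with matched projection $m(Q)$, we have $$\|P-m(Q)\|\le \|P-Q\|.$$
   Context: $\mathcal{L}(H)$ is the $C^*$-algebra of adjointable operators on the Hilbert $C^*$-module $H$, and $I$ is the identity operator on $H$. $\mathcal{R}(\cdot)$ and $\mathcal{N}(\cdot)$ denote range and null space. An idempotent is $Q\in\mathcal{L}(H)$ with $Q^2=Q$; a projection is a self-adjoint idempotent. $P_{\mathcal{R}(Q)}$ is the projection of $H$ onto the (orthogonally complemented) range of $Q$. Definition of the matched projection $m(Q)$ of an idempotent $Q\in\mathcal{L}(H)$: if $Q$ is a projection, $m(Q)=Q$. Otherwise, $H=\mathcal{R}(Q)\dotplus\mathcal{N}(Q^* )$ is an orthogonal decomposition; let $U:H\to\mathcal{R}(Q)\oplus\mathcal{N}(Q^* )$ be the unitary $Uh=\binom{P_{\mathcal{R}(Q)}h}{(I-P_{\mathcal{R}(Q)})h}$, let $I_1$ be the identity on $\mathcal{R}(Q)$, let $A=(Q-P_{\mathcal{R}(Q)})|_{\mathcal{N}(Q^* )}:\mathcal{N}(Q^* )\to\mathcal{R}(Q)$ and $B=(AA^*+I_1)^{1/2}$, and set $$m(Q)=U^*\cdot\frac12\begin{pmatrix}(B+I_1)B^{-1} & B^{-1}A\\ A^*B^{-1} & A^*[B(B+I_1)]^{-1}A\end{pmatrix}\cdot U .$$ *)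

(* Defs.v *)
From HB Require Import structures.
From mathcomp Require Import all_boot all_order all_algebra.
From mathcomp Require Import complex.
From mathcomp Require Import all_classical all_reals all_analysis.

Set Implicit Arguments.
Unset Strict Implicit.
Unset Printing Implicit Defensive.

Import Order.TTheory GRing.Theory Num.Theory.
Import numFieldNormedType.Exports.

Local Open Scope classical_set_scope.
Local Open Scope ring_scope.

(* C*-algebras over the complex numbers R[i]. They need not be unital, so the
   product is not one of the ring structures of the library (all have a 1). *)
HB.mixin Record isCStarAlgebra (R : realType) (A : Type)
    of CompleteNormedModule R[i] A := {
  cmul : A -> A -> A;
  cstar : A -> A;
  cmulA : forall a b c, cmul a (cmul b c) = cmul (cmul a b) c;
  cmulDl : forall a b c, cmul (a + b) c = cmul a c + cmul b c;
  cmulDr : forall a b c, cmul a (b + c) = cmul a b + cmul a c;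
  cmulZl : forall (k : R[i]) a b, cmul (k *: a) b = k *: cmul a b;
  cmulZr : forall (k : R[i]) a b, cmul a (k *: b) = k *: cmul a b;
  cstarK : forall a, cstar (cstar a) = a;
  cstarD : forall a b, cstar (a + b) = cstar a + cstar b;
  cstarZ : forall (k : R[i]) a, cstar (k *: a) = conjc k *: cstar a;
  cstarM : forall a b, cstar (cmul a b) = cmul (cstar b) (cstar a);
  cnormM : forall a b, `|cmul a b| <= `|a| * `|b|;
  cnorm_star : forall a, `|cmul (cstar a) a| = `|a| ^+ 2
}.

#[short(type="cstarAlgType")]
HB.structure Definition CStarAlgebra (R : realType) :=
  {A of CompleteNormedModule R[i] A & isCStarAlgebra R A}.

Definition cpositive (R : realType) (A : cstarAlgType R) (a : A) : Prop :=
  exists b : A, a = cmul (cstar b) b.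

(* Right A-modules with an A-valued Hermitian form (linear in the second
   variable). Adjoints are defined at this level because the form of a
   submodule or of a direct sum of Hilbert modules is then available without
   proving completeness and positivity for it. *)
HB.mixin Record isHermitianModule (R : realType) (A : cstarAlgType R)
    (H : Type) of GRing.Lmodule R[i] H := {
  act : H -> A -> H;
  ip : H -> H -> A;
  actDl : forall x y a, act (x + y) a = act x a + act y a;
  actDr : forall x a b, act x (a + b) = act x a + act x b;
  actZl : forall (k : R[i]) x a, act (k *: x) a = k *: act x a;
  actZr : forall (k : R[i]) x a, act x (k *: a) = k *: act x a;
  actM : forall x a b, act x (cmul a b) = act (act x a) b;
  ipDr : forall x y z, ip x (y + z) = ip x y + ip x z;
  ipZr : forall (k : R[i]) x y, ip x (k *: y) = k *: ip x y;
  ip_act : forall x y a, ip x (act y a) = cmul (ip x y) a;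
  ip_star : forall x y, cstar (ip x y) = ip y x
}.

#[short(type="hermModType")]
HB.structure Definition HermitianModule (R : realType) (A : cstarAlgType R) :=
  {H of GRing.Lmodule R[i] H & isHermitianModule R A H}.

(* Definiteness of the inner product follows from hnormE. *)
HB.mixin Record isHilbertModule (R : realType) (A : cstarAlgType R) (H : Type)
    of CompleteNormedModule R[i] H & isHermitianModule R A H := {
  ip_ge0 : forall x : H, cpositive (ip x x : A);
  hnormE : forall x : H, `|x| ^+ 2 = `|ip x x : A|
}.

#[short(type="hilbertModType")]
HB.structure Definition HilbertModule (R : realType) (A : cstarAlgType R) :=
  {H of CompleteNormedModule R[i] H & isHermitianModule R A H
      & isHilbertModule R A H}.

Section HermitianModuleTheory.
Context {R : realType} {A : cstarAlgType R} {H : hermModType A}.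
Implicit Types x y z : H.

Lemma ipDl x y z : ip (x + y) z = ip x z + ip y z.
Proof. by rewrite -[LHS]cstarK ip_star ipDr cstarD !ip_star. Qed.

Lemma ipr0 x : ip x 0 = 0.
Proof. by rewrite -(scale0r 0) ipZr scale0r. Qed.

Lemma ipNr x y : ip x (- y) = - ip x y.
Proof. by rewrite -scaleN1r ipZr scaleN1r. Qed.

Lemma ipZl (k : R[i]) x y : ip (k *: x) y = conjc k *: ip x y.
Proof. by rewrite -[LHS]cstarK ip_star ipZr cstarZ ip_star. Qed.

Lemma ipNl x y : ip (- x) y = - ip x y.
Proof.
have cstarN (a : A) : cstar (- a) = - cstar a.
  by rewrite -scaleN1r cstarZ rmorphN1 scaleN1r.
by rewrite -[LHS]cstarK ip_star ipNr cstarN ip_star.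
Qed.

End HermitianModuleTheory.

Section HilbertModuleTheory.
Context {R : realType} {A : cstarAlgType R} {H : hilbertModType A}.

Lemma ip_eq0 (x : H) : ip x x = 0 -> x = 0.
Proof.
move=> x0; have := hnormE x; rewrite x0 normr0 => /eqP.
by rewrite sqrf_eq0 normr_eq0 => /eqP.
Qed.

Lemma ip_ext (x y : H) : (forall z : H, ip z x = ip z y) -> x = y.
Proof.
move=> xy; apply/eqP; rewrite -subr_eq0; apply/eqP/ip_eq0.
by rewrite ipDr ipNr xy subrr.
Qed.

End HilbertModuleTheory.

Record adjointable (R : realType) (A : cstarAlgType R) (H K : hermModType A) :=
  Adjointable {
    aop :> H -> K;
    aadj : K -> H;
    aopP : forall x y, ip (aop x) y = ip x (aadj y)
  }.

Notation "''L' ( H , K )" := (adjointable H K)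
  (at level 8, format "''L' ( H ,  K )") : type_scope.
Notation "''L' ( H )" := (adjointable H H)
  (at level 8, format "''L' ( H )") : type_scope.

Section Operators.
Context {R : realType} {A : cstarAlgType R}.
Implicit Types H K L : hermModType A.

Fact adj_subproof H K (T : 'L(H, K)) x y : ip (aadj T x) y = ip x (T y).
Proof. by rewrite -ip_star -aopP ip_star. Qed.
Definition adj H K (T : 'L(H, K)) : 'L(K, H) := Adjointable (adj_subproof T).

Definition idop H : 'L(H) := @Adjointable _ _ H H id id (fun _ _ => erefl).

Fact comp_subproof H K L (S : 'L(K, L)) (T : 'L(H, K)) x y :
  ip (S (T x)) y = ip x (adj T (adj S y)).
Proof. by rewrite !aopP. Qed.
Definition compop H K L (S : 'L(K, L)) (T : 'L(H, K)) : 'L(H, L) :=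
  Adjointable (comp_subproof S T).

Fact add_subproof H K (S T : 'L(H, K)) x y :
  ip (S x + T x) y = ip x (adj S y + adj T y).
Proof. by rewrite ipDl ipDr !aopP. Qed.
Definition addop H K (S T : 'L(H, K)) : 'L(H, K) :=
  Adjointable (add_subproof S T).

Fact scale_subproof H K (k : R[i]) (T : 'L(H, K)) x y :
  ip (k *: T x) y = ip x (conjc k *: adj T y).
Proof. by rewrite ipZl ipZr aopP. Qed.
Definition scaleop H K (k : R[i]) (T : 'L(H, K)) : 'L(H, K) :=
  Adjointable (scale_subproof k T).

Fact sub_subproof H K (S T : 'L(H, K)) x y :
  ip (S x - T x) y = ip x (adj S y - adj T y).
Proof. by rewrite ipDl ipDr ipNl ipNr !aopP. Qed.
Definition subop H K (S T : 'L(H, K)) : 'L(H, K) :=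
  Adjointable (sub_subproof S T).

End Operators.
Arguments idop {R A} H.

Declare Scope adjointable_scope.
Delimit Scope adjointable_scope with L.
Bind Scope adjointable_scope with adjointable.
Notation "T ^*" := (adj T) : adjointable_scope.
Notation "S * T" := (compop S T) : adjointable_scope.
Notation "S + T" := (addop S T) : adjointable_scope.
Notation "S - T" := (subop S T) : adjointable_scope.
Notation "k *: T" := (scaleop k T) : adjointable_scope.

Section SpecialOperators.
Context {R : realType} {A : cstarAlgType R} {H : hermModType A}.
Implicit Types P Q T B S : 'L(H).

Definition is_idempotent Q : Prop := (Q * Q)%L =1 Q.

Definition is_projection P : Prop := is_idempotent P /\ (P^*)%L =1 P.

Definition is_positive T : Prop := exists S, T =1 (S^* * S)%L.

Definition is_sqrt T B : Prop := is_positive B /\ (B * B)%L =1 T.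

Definition is_inverse T S : Prop :=
  (T * S)%L =1 idop H /\ (S * T)%L =1 idop H.

End SpecialOperators.

(* Adjointable operators are automatically bounded; taking the supremum in
   \bar R makes the definition meaningful without appealing to that theorem. *)
Definition opnorm (R : realType) (A : cstarAlgType R) (H K : hilbertModType A)
    (T : 'L(H, K)) : \bar R :=
  ereal_sup [set (complex.Re `|T x|)%:E | x in [set x : H | `|x| <= 1]].

Record submodule (R : realType) (A : cstarAlgType R) (H : hermModType A) :=
  Submodule {
    sub_set : set H;
    sub_set0 : sub_set 0;
    sub_setP : forall (k : R[i]) x y,
      sub_set x -> sub_set y -> sub_set (k *: x + y);
    sub_set_act : forall x (a : A), sub_set x -> sub_set (act x a)
  }.

Section SubmoduleType.
Context {R : realType} {A : cstarAlgType R} {H : hermModType A}.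
Variable S : submodule H.

Definition sub_pred : {pred H} := [pred x | `[< sub_set S x >]].

Fact sub_pred_submod_closed : submod_closed sub_pred.
Proof.
split=> [|k x y]; rewrite !inE; [exact: sub_set0 | exact: sub_setP].
Qed.

HB.instance Definition _ :=
  GRing.isSubmodClosed.Build R[i] H sub_pred sub_pred_submod_closed.

Record subtype_of := SubtypeOf {
  sub_elt :> H;
  sub_eltP : sub_elt \in sub_pred
}.

HB.instance Definition _ := [isSub for sub_elt].
HB.instance Definition _ := [Choice of subtype_of by <:].
HB.instance Definition _ := [SubChoice_isSubLmodule of subtype_of by <:].

Definition mk_sub (x : H) (xS : sub_set S x) : subtype_of := SubtypeOf (asboolT xS).

Lemma sub_eltS (x : subtype_of) : sub_set S x.
Proof. by case: x => x /= /asboolP. Qed.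

Definition sub_act (x : subtype_of) (a : A) : subtype_of :=
  mk_sub (sub_set_act a (sub_eltS x)).
Definition sub_ip (x y : subtype_of) : A := ip (x : H) (y : H).

Fact sub_actDl x y a : sub_act (x + y) a = sub_act x a + sub_act y a.
Proof. by apply: val_inj; rewrite /= actDl. Qed.
Fact sub_actDr x a b : sub_act x (a + b) = sub_act x a + sub_act x b.
Proof. by apply: val_inj; rewrite /= actDr. Qed.
Fact sub_actZl (k : R[i]) x a : sub_act (k *: x) a = k *: sub_act x a.
Proof. by apply: val_inj; rewrite /= actZl. Qed.
Fact sub_actZr (k : R[i]) x a : sub_act x (k *: a) = k *: sub_act x a.
Proof. by apply: val_inj; rewrite /= actZr. Qed.
Fact sub_actM x a b : sub_act x (cmul a b) = sub_act (sub_act x a) b.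
Proof. by apply: val_inj; rewrite /= actM. Qed.
Fact sub_ipDr x y z : sub_ip x (y + z) = sub_ip x y + sub_ip x z.
Proof. exact: ipDr. Qed.
Fact sub_ipZr (k : R[i]) x y : sub_ip x (k *: y) = k *: sub_ip x y.
Proof. exact: ipZr. Qed.
Fact sub_ip_act x y a : sub_ip x (sub_act y a) = cmul (sub_ip x y) a.
Proof. exact: ip_act. Qed.
Fact sub_ip_star x y : cstar (sub_ip x y) = sub_ip y x.
Proof. exact: ip_star. Qed.

HB.instance Definition _ := isHermitianModule.Build R A subtype_of
  sub_actDl sub_actDr sub_actZl sub_actZr sub_actM
  sub_ipDr sub_ipZr sub_ip_act sub_ip_star.

End SubmoduleType.

Section DirectSum.
Context {R : realType} {A : cstarAlgType R}.
Variables X Y : hermModType A.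

Definition sum_act (u : X * Y) (a : A) : X * Y := (act u.1 a, act u.2 a).
Definition sum_ip (u v : X * Y) : A := ip u.1 v.1 + ip u.2 v.2.

Fact sum_actDl u v a : sum_act (u + v) a = sum_act u a + sum_act v a.
Proof. by rewrite /sum_act !actDl. Qed.
Fact sum_actDr u a b : sum_act u (a + b) = sum_act u a + sum_act u b.
Proof. by rewrite /sum_act !actDr. Qed.
Fact sum_actZl (k : R[i]) u a : sum_act (k *: u) a = k *: sum_act u a.
Proof. by rewrite /sum_act !actZl. Qed.
Fact sum_actZr (k : R[i]) u a : sum_act u (k *: a) = k *: sum_act u a.
Proof. by rewrite /sum_act !actZr. Qed.
Fact sum_actM u a b : sum_act u (cmul a b) = sum_act (sum_act u a) b.
Proof. by rewrite /sum_act !actM. Qed.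
Fact sum_ipDr u v w : sum_ip u (v + w) = sum_ip u v + sum_ip u w.
Proof. by rewrite /sum_ip !ipDr addrACA. Qed.
Fact sum_ipZr (k : R[i]) u v : sum_ip u (k *: v) = k *: sum_ip u v.
Proof. by rewrite /sum_ip !ipZr scalerDr. Qed.
Fact sum_ip_act u v a : sum_ip u (sum_act v a) = cmul (sum_ip u v) a.
Proof. by rewrite /sum_ip !ip_act cmulDl. Qed.
Fact sum_ip_star u v : cstar (sum_ip u v) = sum_ip v u.
Proof. by rewrite /sum_ip cstarD !ip_star. Qed.

HB.instance Definition _ := isHermitianModule.Build R A (X * Y)%type
  sum_actDl sum_actDr sum_actZl sum_actZr sum_actM
  sum_ipDr sum_ipZr sum_ip_act sum_ip_star.

Fact block_subproof (a : 'L(X)) (b : 'L(Y, X)) (c : 'L(X, Y)) (d : 'L(Y))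
    (u v : X * Y) :
  ip ((a u.1 + b u.2, c u.1 + d u.2) : X * Y) v =
  ip u ((aadj a v.1 + aadj c v.2, aadj b v.1 + aadj d v.2) : X * Y).
Proof. by rewrite /ip/= /sum_ip/= !ipDl !ipDr !aopP addrACA. Qed.

(* The operator on X (+) Y with matrix (a b; c d). *)
Definition block (a : 'L(X)) (b : 'L(Y, X)) (c : 'L(X, Y)) (d : 'L(Y)) :
  'L((X * Y)%type) := Adjointable (block_subproof a b c d).

End DirectSum.

Section RangeAndNullSpace.
Context {R : realType} {A : cstarAlgType R} {H : hilbertModType A}.
Implicit Types Q T : 'L(H).

Lemma aop_linear T (k : R[i]) x y : T (k *: x + y) = k *: T x + T y.
Proof.
by apply: ip_ext => z; rewrite -adj_subproof !(ipDr, ipZr) !adj_subproof.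
Qed.

Lemma aop0 T : T 0 = 0.
Proof. by apply: ip_ext => z; rewrite -adj_subproof !ipr0. Qed.

Lemma aop_act T x (a : A) : T (act x a) = act (T x) a.
Proof.
by apply: ip_ext => z; rewrite -adj_subproof !ip_act adj_subproof.
Qed.

Fact ran_subproof0 T : range T 0.
Proof. by exists 0 => //; rewrite aop0. Qed.
Fact ran_subproofP T (k : R[i]) x y :
  range T x -> range T y -> range T (k *: x + y).
Proof.
by move=> [u _ <-] [v _ <-]; exists (k *: u + v) => //; rewrite aop_linear.
Qed.
Fact ran_subproof_act T x (a : A) : range T x -> range T (act x a).
Proof. by move=> [u _ <-]; exists (act u a) => //; rewrite aop_act. Qed.

Definition ran T : submodule H :=
  Submodule (ran_subproof0 T) (@ran_subproofP T) (@ran_subproof_act T).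

Fact null_subproofP T (k : R[i]) x y :
  T x = 0 -> T y = 0 -> T (k *: x + y) = 0.
Proof. by move=> x0 y0; rewrite aop_linear x0 y0 scaler0 addr0. Qed.
Fact null_subproof_act T x (a : A) : T x = 0 -> T (act x a) = 0.
Proof.
move=> x0; rewrite aop_act x0.
by have := actZl (0 : R[i]) (0 : H) a; rewrite !scale0r.
Qed.

Definition null T : submodule H :=
  @Submodule _ _ _ [set x | T x = 0]
    (aop0 T) (@null_subproofP T) (@null_subproof_act T).

End RangeAndNullSpace.

(* P_{R(Q)}: the projection of H whose range is that of Q. *)
Record range_projection (R : realType) (A : cstarAlgType R)
    (H : hilbertModType A) (Q : 'L(H)) := RangeProjection {
  rproj :> 'L(H);
  rproj_proj : is_projection rproj;
  rproj_range : range rproj = range Q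
}.

Section MatchedProjection.
Context {R : realType} {A : cstarAlgType R} {H : hilbertModType A}.
Variables (Q : 'L(H)) (PR : range_projection Q).

Let X : hermModType A := subtype_of (ran Q).
Let Y : hermModType A := subtype_of (null (Q^*)%L).

Fact rproj_fix x : range Q x -> PR x = x.
Proof.
rewrite -(rproj_range PR) => -[y _ <-].
by have [idem _] := rproj_proj PR; exact: idem.
Qed.

Fact rproj_adj x : aadj PR x = PR x.
Proof. by have [_ PRs] := rproj_proj PR; exact: PRs. Qed.

Fact rproj_ran h : sub_set (ran Q) (PR h).
Proof.
have PRh : range PR (PR h) by exists h.
by rewrite rproj_range in PRh.
Qed.

Fact rproj_null h : sub_set (null (Q^*)%L) (h - PR h).
Proof.
apply: ip_ext => z; rewrite ipr0 -(aopP Q) ipDr ipNr -[ip _ (PR h)]adj_subproof.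
by rewrite rproj_adj rproj_fix ?subrr//; exists z.
Qed.

Fact ran_null_orth u (y : Y) : ip (Q u) (sub_elt y) = 0.
Proof. by rewrite aopP [aadj Q _](sub_eltS y) ipr0. Qed.

Fact mp_subproof h (x : X) :
  ip (mk_sub (rproj_ran h) : X) x = ip h (sub_elt x).
Proof.
rewrite [LHS](aopP PR) rproj_adj.
by rewrite rproj_fix//; exact: (sub_eltS x).
Qed.

Fact mq_subproof h (y : Y) :
  ip (mk_sub (rproj_null h) : Y) y = ip h (sub_elt y).
Proof.
rewrite [LHS]ipDl ipNl; have [u _ <-] := rproj_ran h.
by rewrite ran_null_orth subr0.
Qed.

(* P_{R(Q)} and I - P_{R(Q)} with values in R(Q) and N(Q^* ); their adjoints
   are the inclusions of R(Q) and N(Q^* ) in H. *)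
Definition mp : 'L(H, X) := Adjointable mp_subproof.
Definition mq : 'L(H, Y) := Adjointable mq_subproof.

Fact mU_subproof h (v : X * Y) :
  ip ((mp h, mq h) : X * Y) v = ip h ((mp^*)%L v.1 + (mq^*)%L v.2).
Proof. by rewrite ipDr -!aopP. Qed.

Definition mU : 'L(H, (X * Y)%type) := Adjointable mU_subproof.

Lemma mU_unitary :
  (mU^* * mU)%L =1 idop H /\ (mU * mU^*)%L =1 idop (X * Y)%type.
Proof.
split=> [h|[x y]] /=; first by rewrite addrC subrK.
have PRy : PR (sub_elt y) = 0.
  apply: ip_ext => z; rewrite ipr0 -adj_subproof rproj_adj.
  have [u _ <-] := rproj_ran z.
  exact: ran_null_orth.
have PRxy : PR (sub_elt x + sub_elt y) = sub_elt x.
  rewrite -[sub_elt x in LHS]scale1r aop_linear PRy addr0 scale1r.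
  by rewrite rproj_fix//; exact: (sub_eltS x).
congr pair; apply: val_inj => /=; first exact: PRxy.
by rewrite PRxy addrAC subrr add0r.
Qed.

(* Q - P_{R(Q)} maps N(Q^* ) into R(Q), so mp only changes its codomain. *)
Definition mA : 'L(Y, X) := (mp * (Q - PR) * mq^*)%L.

Lemma mAE (y : Y) : sub_elt (mA y) = Q (sub_elt y) - PR (sub_elt y).
Proof.
rewrite /= rproj_fix//; have [u _ <-] := rproj_ran (sub_elt y).
exists (-1 *: u + sub_elt y) => //.
by rewrite aop_linear scaleN1r addrC.
Qed.

(* Bi and Ci stand for the inverses of B and B (B + I_1). *)
Definition matched_block (B Bi Ci : 'L(X)) : 'L(H) :=
  (mU^* *
     (2^-1 *: block ((B + idop X) * Bi) (Bi * mA)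
                    (mA^* * Bi)         (mA^* * Ci * mA))
   * mU)%L.

End MatchedProjection.

(* M = m(Q). The data PR, B, Bi, Ci below are unique when they exist, and they
   exist for every idempotent Q. *)
Definition is_matched_projection (R : realType) (A : cstarAlgType R)
    (H : hilbertModType A) (Q M : 'L(H)) : Prop :=
  (is_projection Q /\ M =1 Q) \/
  (~ is_projection Q /\
   exists (PR : range_projection Q) (B Bi Ci : 'L(subtype_of (ran Q))),
     [/\ is_sqrt (mA PR * (mA PR)^* + idop _)%L B,
         is_inverse B Bi,
         is_inverse (B * (B + idop _))%L Ci
       & M =1 matched_block PR B Bi Ci]).

(* Main.v *)
(* Put S = 2Q - I, V = 2 m(Q) - I and U = 2P - I.  Then U and V are self-adjoint
   symmetries, V is the unitary part of the polar decomposition of S, that is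
   V S = S^* V, and D := V S + S V >= 2.  For X = U - S and Y = X^* X + X X^*,
   the average of Y and V Y V controls |X|^2.  With f = (U - V)^2, G = D - 2 and
   l = |f| it can be rewritten as
     Y + V Y V = 2 (G + (f - l)/2)^2 + (4 + 2 l) G + 4 f - (l - f)^2 / 2,
   hence 4 f - (l - f)^2 / 2 <= 4 |X|^2, which forces l <= |X|^2.

   The order arguments need only the C*-identity: a self-adjoint a is called
   positive when |t - a| <= t for some real t, square roots are only approximated,
   and positivity of a^* a is Fukamiya's theorem.  Applied to the operators on A
   viewed as a module over itself, this gives the Cauchy-Schwarz inequality for
   Hilbert A-modules, so that L(H) satisfies the C*-identity as well. *)
From Stdlib Require Ncring Ncring_tac.
From HB Require Import structures.
Require Import Defs.
From mathcomp Require Import all_boot all_order all_algebra.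
From mathcomp Require Import complex ring lra.
From mathcomp Require Import all_classical all_reals all_analysis.

Set Implicit Arguments.
Unset Strict Implicit.
Unset Printing Implicit Defensive.

Import Order.TTheory GRing.Theory Num.Theory.
Import numFieldNormedType.Exports.

Local Open Scope classical_set_scope.
Local Open Scope ring_scope.

(** * Identities in noncommutative rings *)

Section NoncommutativeRingTactic.
Context (B : pzRingType).

#[export] Instance pzRing_ops :
  @Ncring.Ring_ops B 0 1 +%R *%R (fun x y => x - y) -%R eq := {}.

#[export] Instance pzRing_Ring : Ncring.Ring (Ro := pzRing_ops).
Proof.
split; try by [move=> ? ? -> ? ? -> | move=> ? ? ->].
- by split=> // ? ? ? ->.
- exact: add0r.
- exact: addrC.
- exact: addrA.
- exact: mul1r.
- exact: mulr1.
- exact: mulrA.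
- exact: mulrDl.
- by move=> x y z; exact: mulrDr.
- by [].
- exact: subrr.
Qed.

End NoncommutativeRingTactic.

(** Squares, natural multiples and numerals (multiples of 1) are first unfolded into the operations
    of the ring structure declared above. *)
Ltac ncring := rewrite ?(expr2, mulrS, mulr0n); Ncring_tac.non_commutative_ring.

(* [J] stands for the imaginary unit; only real scalars are kept in [scal]. *)
Record cstar_seminorm (R : realType) (B : pzRingType)
    (scal : {rmorphism R -> B}) (J : B) (star : B -> B) (nrm : B -> R) : Prop :=
  CstarSeminorm {
    scalC : forall t a, scal t * a = a * scal t;
    imagC : forall a, J * a = a * J;
    imagM : J * J = -1;
    starK : involutive star;
    starD : forall a b, star (a + b) = star a + star b;
    starM : forall a b, star (a * b) = star b * star a;
    star_scal : forall t, star (scal t) = scal t;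
    star_imag : star J = - J;
    nrm_ge0 : forall a, 0 <= nrm a;
    nrmD : forall a b, nrm (a + b) <= nrm a + nrm b;
    nrmM : forall a b, nrm (a * b) <= nrm a * nrm b;
    nrmZ : forall t a, nrm (scal t * a) = `|t| * nrm a;
    nrm1 : nrm 1 <= 1;
    nrm_cstar : forall a, nrm a ^+ 2 <= nrm (star a * a)
  }.

(** * Order and positivity in a ring with a C*-seminorm *)

Section Positivity.
Context (R : realType) (B : pzRingType) (scal : {rmorphism R -> B}) (J : B)
  (star : B -> B) (nrm : B -> R).
Hypothesis CB : cstar_seminorm scal J star nrm.

Implicit Types (a b c d g h s u x y : B) (t e : R).
Local Notation "a ^!" := (star a).
Local Notation "t %:B" := (scal t) (at level 2, format "t %:B").

Let starD := starD CB.
Let starM := starM CB.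
Let starK := starK CB.
Let star_scal := star_scal CB.
Let nrmD := nrmD CB.
Let nrm_ge0 := nrm_ge0 CB.
Let scalC := scalC CB.
Let imagC := imagC CB.

Lemma star0 : 0^! = 0.
Proof. by apply: (addrI 0^!); rewrite -starD !addr0. Qed.

Lemma starN a : (- a)^! = - a^!.
Proof. by apply: (addrI a^!); rewrite -starD !subrr star0. Qed.

Lemma starB a b : (a - b)^! = a^! - b^!.
Proof. by rewrite starD starN. Qed.

Lemma star1 : 1^! = 1.
Proof. by rewrite -(rmorph1 scal) star_scal. Qed.

Lemma nrm0 : nrm 0 = 0.
Proof. by rewrite -(mulr0 0%:B) (nrmZ CB) normr0 mul0r. Qed.

Lemma nrmN a : nrm (- a) = nrm a.
Proof.
have -> : - a = (-1)%:B * a by rewrite rmorphN1 mulN1r.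
by rewrite (nrmZ CB) normrN normr1 mul1r.
Qed.

Lemma nrm_distC a b : nrm (a - b) = nrm (b - a).
Proof. by rewrite -nrmN opprB. Qed.

Lemma nrm_le_dist a b : nrm a <= nrm b + nrm (a - b).
Proof. by rewrite -[in leLHS](subrK b a) addrC nrmD. Qed.

Lemma nrm_scal t : nrm t%:B <= `|t|.
Proof. by rewrite -[t%:B]mulr1 (nrmZ CB) ler_piMr ?(nrm1 CB). Qed.

Lemma nrm_star_le a : nrm a <= nrm a^!.
Proof.
have := le_trans (nrm_cstar CB a) (nrmM CB _ _).
have := nrm_ge0 a; rewrite le0r => /predU1P[-> //|a0].
by rewrite expr2 ler_pM2r.
Qed.

Lemma nrm_star a : nrm a^! = nrm a.
Proof. by apply/le_anti; rewrite nrm_star_le -{2}(starK a) nrm_star_le. Qed.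

Lemma nrm_starM a : nrm (a^! * a) = nrm a ^+ 2.
Proof.
by apply/le_anti; rewrite (nrm_cstar CB) expr2 -{1}(nrm_star a) (nrmM CB).
Qed.

Lemma half2 a : (2^-1)%:B * (a + a) = a.
Proof.
rewrite -mulr2n -[a *+ 2]mulr_natl mulrA -(rmorph_nat scal) -rmorphM mulVf ?pnatr_eq0//.
by rewrite rmorph1 mul1r.
Qed.

Section SquareRoot.
Variable u : B.
Hypotheses (su : u^! = u) (u1 : nrm u <= 1).

(* [y] tends to [1 - sqrt (1 - u)]; [a] is the same iteration at [u = 1] and
   majorizes it. *)
Let y := fix y n := if n is n'.+1 then (2^-1)%:B * (u + y n' * y n') else 0.
Let a := fix a n : R := if n is n'.+1 then (1 + a n' ^+ 2) / 2 else 0.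

Let star_y n : (y n)^! = y n.
Proof.
by elim: n => [|n IH] /=; rewrite ?star0// starM starD starM IH su star_scal scalC.
Qed.

Let comm_y c n : c * u = u * c -> c * y n = y n * c.
Proof.
move=> cu; elim: n => [|n IH] /=; first by rewrite mulr0 mul0r.
rewrite mulrA -scalC -!mulrA; congr (_ * _).
by rewrite mulrDr mulrDl cu mulrA IH -mulrA IH mulrA.
Qed.

Let a01 n : 0 <= a n <= 1.
Proof. by elim: n => [|n /andP[? ?]] /=; [lra|nra]. Qed.

Let nrm_y n : nrm (y n) <= a n.
Proof.
elim: n => [|n IH] /=; first by rewrite nrm0.
rewrite (nrmZ CB) ger0_norm ?invr_ge0// [leRHS]mulrC ler_pM2l ?invr_gt0//.
apply: le_trans (nrmD _ _) _; apply: lerD => //.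
by apply: le_trans (nrmM CB _ _) _; rewrite expr2 ler_pM.
Qed.

Let dist_y n : nrm (y n.+1 - y n) <= a n.+1 - a n.
Proof.
elim: n => [|n IH].
  rewrite /= !mulr0 !subr0 addr0 (nrmZ CB) ger0_norm ?invr_ge0//.
  by rewrite expr0n addr0 mul1r ler_piMr ?invr_ge0.
have -> : y n.+2 - y n.+1 =
    (2^-1)%:B * (y n.+1 * (y n.+1 - y n) + (y n.+1 - y n) * y n).
  have E k : y k.+1 = (2^-1)%:B * (u + y k * y k) by [].
  by rewrite (E n.+1) {3}(E n); move: (y n.+1) (y n) => p q; ncring.
have -> : a n.+2 - a n.+1 = 2^-1 * ((a n.+1 - a n) * (a n.+1 + a n)).
  have E k : a k.+1 = (1 + a k ^+ 2) / 2 by [].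
  by rewrite (E n.+1) {2}(E n); field.
rewrite (nrmZ CB) ger0_norm ?invr_ge0// ler_pM2l ?invr_gt0//.
apply: le_trans (nrmD _ _) _; rewrite [leRHS]mulrDr; apply: lerD.
  by rewrite [leRHS]mulrC; apply: le_trans (nrmM CB _ _) _; rewrite ler_pM.
by apply: le_trans (nrmM CB _ _) _; rewrite ler_pM.
Qed.

(** The increments of [a] are nonincreasing, so [n.+1] copies of the last one are at most their
    telescoping sum. As [a] stays below 1, the iteration has an explicit rate, and no limit has to
    be taken in [B]. *)
Let dist_a n : n.+1%:R * (a n.+1 - a n) <= a n.+1.
Proof.
elim: n => [|n IH]; first by rewrite mul1r subr0.
rewrite -natr1 mulrDl mul1r; set d := a n.+2 - a n.+1.
suff h : d <= a n.+1 - a n.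
  apply: le_trans (lerD (ler_wpM2l _ h) (lexx d)) _ => //.
  by rewrite -(lerD2r d) in IH; apply: le_trans IH _; rewrite /d addrC subrK.
have E k : a k.+1 = (1 + a k ^+ 2) / 2 by [].
have /andP[r0 r1] := a01 n; have /andP[q0 q1] := a01 n.+1.
have qE := E n; rewrite /d (E n.+1); move: (a n.+1) (a n) q0 q1 r0 r1 qE => q r *.
have rq : r <= q by have := sqr_ge0 (1 - r); lra.
have : (1 - q) ^+ 2 <= (1 - r) ^+ 2 by rewrite ler_pXn2r ?nnegrE //; lra.
lra.
Qed.

(** The root is [1 - y n]: its defect is exactly twice the increment [y n.+1 - y n], hence at most
    [2 / n.+1]. *)
Lemma approx_sqrt_subr e : 0 < e -> exists s,
  [/\ s^! = s, (forall c, c * u = u * c -> c * s = s * c)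
    & nrm (s * s - (1 - u)) <= e].
Proof.
move=> e0; pose n := Num.truncn (2 / e).
exists (1 - y n); split=> [|c cu|]; first by rewrite starB star1 star_y.
  by rewrite mulrBr mulrBl mulr1 mul1r comm_y.
have -> : (1 - y n) * (1 - y n) - (1 - u) = 2%:B * (y n.+1 - y n).
  have -> : y n.+1 = (2^-1)%:B * (u + y n * y n) by [].
  rewrite [RHS]mulrBr [in RHS]mulrA -rmorphM mulfV ?pnatr_eq0//.
  by rewrite rmorph1 rmorph_nat; move: (y n) => p; ncring.
rewrite (nrmZ CB) ger0_norm//.
have h : n.+1%:R * (a n.+1 - a n) <= 1.
  by apply: le_trans (dist_a n) _; case/andP: (a01 n.+1).
have h2 : 2 / e < n.+1%:R by rewrite Num.Theory.truncnS_gt.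
rewrite -ler_pdivlMl// mulrC; apply: le_trans (dist_y n) _.
apply: (@le_trans _ _ n.+1%:R^-1).
  by rewrite -(ler_pM2l (ltr0Sn R n)) mulfV ?pnatr_eq0.
by rewrite -[e / 2]invf_div lef_pV2 ?posrE ?divr_gt0// ltW.
Qed.

End SquareRoot.

(** In a C*-algebra the inequality says that the spectrum lies in [[0, 2 t]]. In this form sums and
    nonnegative multiples are immediate, and so is the rescaling [a = t (1 - u)] with [nrm u <= 1]
    used for square roots. *)
Definition pos a := a^! = a /\ exists t, nrm (t%:B - a) <= t.

Lemma approx_sqrt a e : pos a -> 0 < e -> exists s,
  [/\ s^! = s, (forall c, c * a = a * c -> c * s = s * c)
    & nrm (s * s - a) <= e].
Proof.
move=> [sa [t at_]] e0; have := le_trans (nrm_ge0 _) at_.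
rewrite le0r => /predU1P[t0|t0].
  exists 0; split; rewrite ?star0//; first by move=> c _; rewrite mulr0 mul0r.
  by move: at_; rewrite mul0r t0 rmorph0 => /le_trans; apply; exact: ltW.
pose u := 1 - (t^-1)%:B * a.
have tu : t%:B * (1 - u) = a.
  by rewrite /u opprB addrC subrK mulrA -rmorphM mulfV ?gt_eqF// rmorph1 mul1r.
have [|||s [ss sc se]] := @approx_sqrt_subr u _ _ (e / t).
- by rewrite /u starB star1 starM star_scal sa -scalC.
- rewrite -(ler_pM2l t0) mulr1; apply: le_trans at_.
  rewrite -[X in X * nrm _](ger0_norm (ltW t0)) -(nrmZ CB) /u mulrBr mulr1 mulrA -rmorphM.
  by rewrite mulfV ?gt_eqF// rmorph1 mul1r.
- exact: divr_gt0.
exists ((Num.sqrt t)%:B * s); split.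
- by rewrite starM star_scal ss scalC.
- move=> c ca; rewrite mulrA -scalC -!mulrA sc//.
  by rewrite mulrBr mulrBl mulr1 mul1r mulrA -scalC -!mulrA ca.
- have -> : (Num.sqrt t)%:B * s * ((Num.sqrt t)%:B * s) = t%:B * (s * s).
    rewrite -[in RHS](sqr_sqrtr (ltW t0)) expr2 rmorphM -!mulrA; congr (_ * _).
    by rewrite !mulrA scalC.
  by rewrite -tu -mulrBr (nrmZ CB) gtr0_norm// mulrC -ler_pdivlMr.
Qed.

(** The element [n = a + J b] is normal with [n^* n = a^2 + b^2], and [a] is its real part, so
    [nrm a <= nrm n]. *)
Lemma nrm_sqr_le a b : a^! = a -> b^! = b -> a * b = b * a ->
  nrm a ^+ 2 <= nrm (a * a + b * b).
Proof.
move=> sa sb ab; pose n := a + J * b.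
have nE : n^! = a - J * b by rewrite starD starM sa sb (star_imag CB) mulrN imagC.
have n2 : n^! * n = a * a + b * b.
  rewrite nE /n; have JbJb : J * b * (J * b) = - (b * b).
    by rewrite -mulrA (mulrA b) -imagC -mulrA mulrA (imagM CB) mulN1r.
  have aJb : a * (J * b) = J * b * a by rewrite mulrA -imagC -mulrA ab mulrA.
  by rewrite mulrBl !mulrDr JbJb aJb; ncring.
rewrite -n2 nrm_starM ler_pXn2r ?nnegrE//.
have -> : a = (2^-1)%:B * (n + n^!).
  by rewrite nE /n addrACA subrr addr0 half2.
rewrite (nrmZ CB) ger0_norm ?invr_ge0//.
have := nrmD n n^!; rewrite nrm_star; set p := nrm _; set q := nrm _; lra.
Qed.

(** Since [t - b^2] is positive, it has approximate roots [s] commuting with [b]. Then [nrm s ^+ 2]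
    is at most the norm of [s^2 + b^2], which is nearly [t]. *)
Lemma nrm_subr_sqr b t : b^! = b -> nrm (b * b) <= t -> nrm (t%:B - b * b) <= t.
Proof.
move=> sb bt; set a := t%:B - b * b.
have pa : pos a.
  split; first by rewrite starB star_scal starM sb.
  by exists t; rewrite opprB addrC subrK.
apply/ler_addgt0Pr => e e0.
have [|s [ss sc se]] := @approx_sqrt a (e / 2) pa; first by rewrite divr_gt0.
have t0 : 0 <= t := le_trans (nrm_ge0 _) bt.
have bs : b * s = s * b.
  by apply: sc; rewrite mulrBr mulrBl -scalC mulrA.
have := nrm_sqr_le ss sb (esym bs); have := nrm_le_dist a (s * s).
have := nrmM CB s s; rewrite nrm_distC.
have -> : s * s + b * b = t%:B + (s * s - a) by rewrite /a; ncring.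
have := nrmD t%:B (s * s - a); have := nrm_scal t; rewrite (ger0_norm t0) -expr2.
by move: (nrm _) (nrm _) (nrm _) (nrm _) (nrm _) se => *; lra.
Qed.

(** One constant, [nrm a + 1], witnesses positivity of every square within 1 of [a], so the
    inequality passes to the limit. *)
Lemma pos_lim a : a^! = a ->
  (forall e, 0 < e -> exists s, s^! = s /\ nrm (s * s - a) <= e) -> pos a.
Proof.
move=> sa H; split=> //; exists (nrm a + 1); apply/ler_addgt0Pr => e e0.
have e1 : 0 < Num.min e 1 by rewrite lt_min e0 ltr01.
have [s [ss se]] := H _ e1.
have [se1 se2] : nrm (s * s - a) <= e /\ nrm (s * s - a) <= 1.
  by move: se; rewrite le_min => /andP[].
have h := nrm_subr_sqr (t := nrm a + 1) ss
  (le_trans (nrm_le_dist _ a) (lerD (lexx _) se2)).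
apply: le_trans (lerD h se1).
have {1}-> : (nrm a + 1)%:B - a = ((nrm a + 1)%:B - s * s) + (s * s - a) by ncring.
exact: nrmD.
Qed.

Lemma pos_sa a : pos a -> a^! = a. Proof. by case. Qed.

Lemma pos_sqr b : b^! = b -> pos (b * b).
Proof.
move=> sb; split; first by rewrite starM sb.
by exists (nrm (b * b)); apply: nrm_subr_sqr.
Qed.

Lemma pos_closed a : a^! = a ->
  (forall e, 0 < e -> exists c, pos c /\ nrm (c - a) <= e) -> pos a.
Proof.
move=> sa H; apply: pos_lim => // e e0.
have e20 : 0 < e / 2 by rewrite divr_gt0.
have [c [pc ca]] := H _ e20; have [s [ss _ sc]] := approx_sqrt pc e20.
exists s; split => //; rewrite [e]splitr; apply: le_trans (lerD sc ca).
have -> : s * s - a = (s * s - c) + (c - a) by ncring.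
exact: nrmD.
Qed.

Lemma posD a b : pos a -> pos b -> pos (a + b).
Proof.
move=> [sa [t ta]] [sb [r rb]]; split; first by rewrite starD sa sb.
exists (t + r); apply: le_trans (lerD ta rb).
by rewrite rmorphD opprD addrACA nrmD.
Qed.

Lemma pos_scal t : 0 <= t -> pos t%:B.
Proof. by move=> t0; split; [exact: star_scal | exists t; rewrite subrr nrm0]. Qed.

Lemma posZ t a : 0 <= t -> pos a -> pos (t%:B * a).
Proof.
move=> t0 [sa [r ra]]; split; first by rewrite starM star_scal sa scalC.
by exists (t * r); rewrite rmorphM -mulrBr (nrmZ CB) ger0_norm// ler_wpM2l.
Qed.

(** Approximate roots [s] and [r] of [a] and [c] commute with each other, so [s r] is self-adjoint
    and its square approximates [a c]. *)
Lemma pos_mul a c : pos a -> pos c -> a * c = c * a -> pos (a * c).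
Proof.
move=> pa pc ac; have [sa sc] := (pos_sa pa, pos_sa pc).
apply: pos_lim => [|e e0]; first by rewrite starM sa sc.
(* With both roots accurate to [e1 <= 1], the error is at most [e1 (nrm c + e1) + nrm a e1], hence
   at most [e1 M]. *)
pose M := nrm a + nrm c + 1.
have M0 : 0 < M by rewrite ltr_wpDl// addr_ge0.
pose e1 := Num.min (e / M) 1.
have e10 : 0 < e1 by rewrite lt_min ltr01 divr_gt0.
have [e1M e11] : e1 * M <= e /\ e1 <= 1.
  by rewrite -ler_pdivlMr//; split; rewrite ge_min lexx ?orbT.
have [s [ss sC sE]] := approx_sqrt pa e10.
have [r [rr rC rE]] := approx_sqrt pc e10.
have sr : s * r = r * s by apply: rC; rewrite sC.
exists (s * r); split; first by rewrite starM ss rr.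
have -> : s * r * (s * r) - a * c = (s * s - a) * (r * r) + a * (r * r - c).
  by rewrite -(mulrA s r) (mulrA r s) -sr; ncring.
apply: le_trans (nrmD _ _) _; apply: le_trans _ e1M.
have h1 : nrm ((s * s - a) * (r * r)) <= e1 * (nrm c + e1).
  apply: le_trans (nrmM CB _ _) _; apply: ler_pM => //.
  by apply: le_trans (nrm_le_dist _ c) _; rewrite lerD2l.
have h2 : nrm (a * (r * r - c)) <= nrm a * e1.
  by apply: le_trans (nrmM CB _ _) _; apply: ler_wpM2l.
by apply: le_trans (lerD h1 h2) _; rewrite /M; move: (nrm_ge0 a); nra.
Qed.

Lemma pos_scal_subr d t : d^! = d -> nrm d <= t -> pos (t%:B - d).
Proof.
move=> sd dt; split; first by rewrite starB star_scal sd.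
by exists t; rewrite opprB addrC subrK.
Qed.

Lemma pos_scal_addr d t : d^! = d -> nrm d <= t -> pos (t%:B + d).
Proof.
by move=> sd dt; rewrite -{1}(opprK d); apply: pos_scal_subr; rewrite ?nrmN// starN sd.
Qed.

(** The product [(t - d) (t + d)], equal to [t^2 - d^2], is positive. With [s] an approximate root
    of it, [nrm d ^+ 2] is at most the norm of [d^2 + s^2], which is nearly [t^2]. *)
Lemma nrm_le_pos d t : 0 <= t -> pos (t%:B - d) -> pos (t%:B + d) -> nrm d <= t.
Proof.
move=> t0 p1 p2.
have sd : d^! = d.
  by have := pos_sa p2; rewrite starD star_scal => /addrI.
(* [ncring] does not know that scalars are central, so this vanishing commutator is kept explicit in
   the identities below. *)
have td0 : t%:B * d - d * t%:B = 0 by rewrite scalC subrr.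
have p3 : pos ((t%:B - d) * (t%:B + d)).
  apply: pos_mul => //.
  have -> : (t%:B + d) * (t%:B - d) =
      (t%:B - d) * (t%:B + d) - (t%:B * d - d * t%:B) *+ 2 by ncring.
  by rewrite td0 mul0rn subr0.
rewrite -(ler_pXn2r (n := 2)) ?nnegrE//; apply/ler_addgt0Pr => e e0.
have [s [ss sc se]] := approx_sqrt p3 e0.
have ds : d * s = s * d.
  apply: sc; apply/eqP; rewrite -subr_eq0; apply/eqP.
  have -> : d * ((t%:B - d) * (t%:B + d)) - (t%:B - d) * (t%:B + d) * d =
      - (t%:B * d - d * t%:B) * (t%:B + d) + (t%:B - d) * - (t%:B * d - d * t%:B)
    by ncring.
  by rewrite td0 oppr0 mul0r mulr0 addr0.
apply: le_trans (nrm_sqr_le sd ss ds) _.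
have -> : d * d + s * s = (t ^+ 2)%:B + (s * s - (t%:B - d) * (t%:B + d))
    + (t%:B * d - d * t%:B).
  by rewrite expr2 rmorphM; ncring.
rewrite td0 addr0; apply: le_trans (nrmD _ _) _; apply: lerD => //.
by apply: le_trans (nrm_scal _) _; rewrite ger0_norm// sqr_ge0.
Qed.

(* [h (3 - 4h)^2] is [sin^2 (3 t)] for [h = sin^2 t]: it stays below 1 on [h <= 1]
   and multiplies small negative values by about 9. *)
Lemma sin3_sqr h : 1 - (3 - h *+ 4) * h * (3 - h *+ 4) =
  (1 - h) * ((1 - h *+ 4) * (1 - h *+ 4)).
Proof. by ncring. Qed.

Lemma pos1_sub_sin3 h : h^! = h -> nrm h <= 1 ->
  pos (1 - (3 - h *+ 4) * h * (3 - h *+ 4)).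
Proof.
move=> sh h1; rewrite sin3_sqr; apply: pos_mul; last by ncring.
  by rewrite -(rmorph1 scal); apply: pos_scal_subr.
apply: pos_sqr; rewrite starB star1; congr (1 - _).
by rewrite !mulrS mulr0n !starD star0 sh.
Qed.

Let star_nat n a : a^! = a -> (a *+ n)^! = a *+ n.
Proof.
by move=> sa; elim: n => [|n IH]; rewrite ?mulr0n ?star0// mulrS starD sa IH.
Qed.

(** Up to a factor, this is the sum of the squares of the self-adjoint real and imaginary parts of
    [y]. *)
Lemma pos_starM_addM y : pos (y^! * y + y * y^!).
Proof.
have -> : y^! * y + y * y^! = (2^-1)%:B * ((y + y^!) * (y + y^!)
    + (J * (y - y^!)) * (J * (y - y^!))).
  rewrite -[LHS]half2; congr (_ * _).
  have -> : J * (y - y^!) * (J * (y - y^!)) = - ((y - y^!) * (y - y^!)).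
    by rewrite -mulrA (mulrA _ J) -imagC -mulrA mulrA (imagM CB) mulN1r.
  by ncring.
apply: posZ; first by rewrite invr_ge0.
apply: posD; apply: pos_sqr; first by rewrite starD starK addrC.
by rewrite starM starB starK (star_imag CB) mulrN -mulNr opprB imagC.
Qed.

(** A lower bound [- c] for [g^* g], valid for all contractions, improves ninefold: it is applied to
    [y = g (3 - 4 h)], for which [y^* y] is the triple-angle polynomial in [h]. *)
Let pos_starM_step (c : R) : 0 <= c ->
  (forall g, nrm g <= 1 -> pos (c%:B + g^! * g)) ->
  forall g, nrm g <= 1 -> pos ((c / 9)%:B + g^! * g).
Proof.
move=> c0 H g g1; pose h := g^! * g; pose k := g * g^!.
have sh : h^! = h by rewrite starM starK.
have sk : k^! = k by rewrite starM starK.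
have h1 : nrm h <= 1 by rewrite nrm_starM expr_le1.
have k1 : nrm k <= 1 by rewrite /k -{1}(starK g) nrm_starM nrm_star expr_le1.
pose y := g * (3 - h *+ 4).
have sf : (3 - h *+ 4)^! = 3 - h *+ 4.
  by rewrite starB !star_nat ?star1.
have yy : y^! * y = (3 - h *+ 4) * h * (3 - h *+ 4).
  by rewrite starM sf /y /h !mulrA.
have yy' : y * y^! = (3 - k *+ 4) * k * (3 - k *+ 4).
  by rewrite starM sf /y /h /k; ncring.
have ph : pos (1 - y^! * y) by rewrite yy; exact: pos1_sub_sin3.
(* Positivity of [y^* y] is not yet available. A lower bound comes instead from [y y^* <= 1] and the
   positivity of the symmetric sum; with [ph] it makes [y] a contraction. *)
have ph' : pos (1 + y^! * y).
  have -> : 1 + y^! * y = (y^! * y + y * y^!) + (1 - y * y^!) by ncring.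
  apply: posD; first exact: pos_starM_addM.
  by rewrite yy'; exact: pos1_sub_sin3.
have y1 : nrm y <= 1.
  have : nrm (y^! * y) <= 1 by apply: nrm_le_pos; rewrite ?rmorph1.
  by rewrite nrm_starM expr_le1.
have := H y y1; rewrite yy => Hy.
have p3 : pos (3 - h *+ 2).
  have -> : 3 - h *+ 2 = 1 + ((1 - h) + (1 - h)) by ncring.
  have p1 : pos (1 - h) by rewrite -(rmorph1 scal); apply: pos_scal_subr.
  apply: posD; last exact: posD.
  by rewrite -(rmorph1 scal); apply: pos_scal.
(* As [h (3 - 4 h)^2 + 8 (3 - 2 h) h^2 = 9 h], adding this positive term leaves only the linear
   part. *)
have p8 : pos (8%:B * ((3 - h *+ 2) * (h * h))).
  apply: posZ => //; apply: pos_mul => //; last by ncring.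
  exact: pos_sqr.
have : pos ((9^-1)%:B * (c%:B + (3 - h *+ 4) * h * (3 - h *+ 4)
    + 8%:B * ((3 - h *+ 2) * (h * h)))).
  by apply: posZ; [rewrite invr_ge0 | exact: posD].
rewrite rmorph_nat.
have -> : c%:B + (3 - h *+ 4) * h * (3 - h *+ 4) + 8 * ((3 - h *+ 2) * (h * h))
  = c%:B + 9 * h by ncring.
rewrite mulrDr -rmorphM mulrC -(rmorph_nat scal 9) mulrA -rmorphM.
by rewrite mulVf ?pnatr_eq0// rmorph1 mul1r.
Qed.

(* Fukamiya's theorem *)
Lemma pos_starM g : pos (g^! * g).
Proof.
have sg a : (a^! * a)^! = a^! * a by rewrite starM starK.
(* Start from the trivial lower bound [- 1] and divide by 9 at each step; closedness of [pos] then
   removes the constant. General [g] are rescaled to contractions at the end. *)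
have H n : forall a, nrm a <= 1 -> pos ((9^-1 ^+ n)%:B + a^! * a).
  elim: n => [a a1|n IH a a1].
    by apply: pos_scal_addr; rewrite // expr0 nrm_starM expr_le1.
  by rewrite exprSr; apply: pos_starM_step => //; rewrite exprn_ge0.
have H1 a : nrm a <= 1 -> pos (a^! * a).
  move=> a1; apply: pos_closed => // e e0.
  have [n ne] : exists n, 9^-1 ^+ n <= e.
    have [n _ hn] : \forall n \near \oo, `|9^-1 ^+ n : R| < e.
      have /cvgr0Pnorm_lt : (9^-1 : R) ^+ n @[n --> \oo] --> 0.
        by apply: cvg_expr; rewrite ger0_norm// invf_lt1 ?ltr1n.
      exact.
    exists n; apply: le_trans (ler_norm _) (ltW (hn _ _)) => /=.
    exact: leqnn.
  exists ((9^-1 ^+ n)%:B + a^! * a); split; first exact: H.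
  rewrite addrK; apply: le_trans (nrm_scal _) _.
  by rewrite ger0_norm// exprn_ge0.
pose t := nrm g + 1; have t0 : 0 < t by rewrite ltr_wpDl.
have : pos ((t ^+ 2)%:B * (((t^-1)%:B * g)^! * ((t^-1)%:B * g))).
  apply: posZ; rewrite ?sqr_ge0//; apply: H1.
  rewrite (nrmZ CB) gtr0_norm ?invr_gt0// mulrC ler_pdivrMr// mul1r.
  by rewrite lerDl.
rewrite starM star_scal -scalC -mulrA [g^! * _]mulrA -scalC !mulrA -!rmorphM.
by rewrite expr2 mulfK ?gt_eqF// mulfV ?gt_eqF// rmorph1 mul1r.
Qed.

Lemma pos_conj x a : pos a -> pos (x^! * a * x).
Proof.
move=> pa; apply: pos_closed => [|e e0].
  by rewrite !starM starK (pos_sa pa) mulrA.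
have e1 : 0 < e / (nrm x ^+ 2 + 1) by rewrite divr_gt0// ltr_wpDl// sqr_ge0.
have [s [ss _ se]] := approx_sqrt pa e1.
exists ((s * x)^! * (s * x)); split; first exact: pos_starM.
have -> : (s * x)^! * (s * x) - x^! * a * x = x^! * (s * s - a) * x.
  by rewrite starM ss; ncring.
apply: le_trans (nrmM CB _ _) _.
apply: le_trans (ler_wpM2r (nrm_ge0 _) (nrmM CB _ _)) _.
rewrite nrm_star mulrAC -expr2.
apply: le_trans (ler_wpM2l (sqr_ge0 _) se) _.
have M0 : 0 < nrm x ^+ 2 + 1 by rewrite ltr_wpDl// sqr_ge0.
by rewrite mulrCA ler_piMr ?(ltW e0)// ler_pdivrMr// mul1r lerDl.
Qed.

Lemma nrm_le_of_pos_sub a b : pos a -> pos (b - a) -> nrm a <= nrm b.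
Proof.
move=> pa pba.
have sb : b^! = b.
  by have := pos_sa (posD pa pba); rewrite addrC subrK.
apply: nrm_le_pos => //.
  have -> : (nrm b)%:B - a = ((nrm b)%:B - b) + (b - a) by ncring.
  by apply: posD => //; apply: pos_scal_subr.
by apply: posD => //; apply: pos_scal.
Qed.

(** * The norm inequality for the symmetries [U], [V] and the involution [S] *)

Section Symmetries.
Variables U V S : B.
Hypotheses (sU : U^! = U) (sV : V^! = V) (UU : U * U = 1) (VV : V * V = 1).
Hypotheses (SS : S * S = 1) (VS : V * S = S^! * V).
Let D := V * S + S * V.
Hypothesis pD : pos (D - 2).

Let X := U - S.
Let Y := X^! * X + X * X^!.
Let f := (U - V) * (U - V).

Let starS : S^! = V * S * V.
Proof. by rewrite VS -mulrA VV mulr1. Qed.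

Let VD : V * D = D * V.
Proof.
rewrite /D mulrDr mulrDl !mulrA VV mul1r -!mulrA VV mulr1; ncring.
Qed.

(** The terms of [Y] linear in [S] involve only [S + S^* = V D], and the quadratic ones are given by
    [D^2 = S^* S + S S^* + 2]. This eliminates [S]. *)
Let YE : Y = D * D - U * (V * D) - V * D * U.
Proof.
have SSs : S + S^! = V * D by rewrite /D mulrDr mulrA VV mul1r starS mulrA.
have DD : D * D = S^! * S + S * S^! + 2.
  rewrite /D mulrDl !mulrDr starS.
  rewrite [V * S * (S * V)]mulrA -(mulrA V S S) SS mulr1 VV.
  rewrite [S * V * (V * S)]mulrA -(mulrA S V V) VV mulr1 SS.
  by ncring.
rewrite DD -SSs /Y /X starB sU.
have -> : 2 = U * U + U * U :> B by rewrite UU.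
by ncring.
Qed.

(** Conjugation by [V] fixes [D], so the average contains [U] only through [U V + V U], which is
    [2 - f]. *)
Let sum_YE : Y + V * Y * V =
  D * D *+ 2 - (U * V + V * U) * D - D * (U * V + V * U).
Proof.
have VDV : V * D * V = D by rewrite VD -mulrA VV mulr1.
rewrite YE mulrBr !mulrBl mulrBr mulrBl.
have -> : V * (D * D) * V = D * D.
  by rewrite mulrA VD -!mulrA (mulrA V D V) VDV.
have -> : V * (U * (V * D)) * V = V * U * D.
  by rewrite -{2}VDV !mulrA.
have -> : V * (V * D * U) * V = D * U * V by rewrite !mulrA VV mul1r.
by have -> : V * D * U = D * V * U by [rewrite VD]; ncring.
Qed.

Lemma nrm_sub_symmetry : nrm (U - V) <= nrm (U - S).
Proof.
pose N := nrm X ^+ 2; pose l := nrm (U - V) ^+ 2.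
have sUV : (U - V)^! = U - V by rewrite starB sU sV.
have nf : nrm f = l by rewrite /f -{1}sUV nrm_starM.
rewrite -(ler_pXn2r (n := 2)) ?nnegrE// -/l -[U - S]/X -/N leNgt.
apply/negP => Nl.
have l0 : 0 <= l := sqr_ge0 _.
have N0 : 0 <= N := sqr_ge0 _.
pose G := D - 2; pose z := l%:B - f.
have pf : pos f by exact: pos_sqr.
have pz : pos z by apply: pos_scal_subr; rewrite ?nf// (pos_sa pf).
have nV : nrm V <= 1.
  by rewrite -(expr_le1 (n := 2))// -nrm_starM sV VV (nrm1 CB).
have sY : Y^! = Y by rewrite starD !starM starK.
have nY : nrm Y <= 2 * N.
  apply: le_trans (nrmD _ _) _; rewrite nrm_starM -{2}(starK X) nrm_starM nrm_star.
  by rewrite /N; lra.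
have nVYV : nrm (V * Y * V) <= 2 * N.
  apply: le_trans (nrmM CB _ _) _; apply: le_trans (ler_piMr (nrm_ge0 _) nV) _.
  apply: le_trans (nrmM CB _ _) _; apply: le_trans (ler_piMl (nrm_ge0 _) nV) nY.
pose L := Y + V * Y * V.
have p1 : pos ((8 * N)%:B - 2%:B * L).
  apply: pos_scal_subr.
    by rewrite starM star_scal -scalC starD sY !starM sV sY mulrA.
  rewrite (nrmZ CB) ger0_norm//; have := nrmD Y (V * Y * V); rewrite -/L.
  by move: nY nVYV; move: (nrm _) (nrm _) (nrm _) => *; lra.
have sG : G^! = G := pos_sa pD.
have p2 : pos ((G *+ 2 - z) * (G *+ 2 - z)).
  by apply: pos_sqr; rewrite starB (pos_sa pz) mulr2n starD sG.
have p3 : pos ((8 + 4 * l)%:B * G).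
  by apply: posZ pD; rewrite addr_ge0// mulr_ge0.
(* The identity for [Y + V Y V], doubled to clear denominators; [z] is [l - f]. *)
have LE : 2%:B * L = (G *+ 2 - z) * (G *+ 2 - z) + (8 + 4 * l)%:B * G
    + 8 * f - z * z.
  have fE : U * V + V * U = 2 - l%:B + z.
    rewrite /z /f; have -> : 2 = U * U + V * V :> B by rewrite UU VV.
    by ncring.
  have DE : D = G + 2 by rewrite /G subrK.
  have fz : f = l%:B - z by rewrite /z; ncring.
  have lG : l%:B * G = G * l%:B by rewrite scalC.
  rewrite /L sum_YE fE DE fz rmorph_nat rmorphD rmorphM !rmorph_nat.
  have -> : (8 + 4 * l%:B) * G = 8 * G + 2 * (l%:B * G) + 2 * (l%:B * G) by ncring.
  by rewrite {2}lG; ncring.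
have p4 : pos ((8 * N)%:B - 8 * f + z * z).
  have -> : (8 * N)%:B - 8 * f + z * z = ((8 * N)%:B - 2%:B * L)
      + ((G *+ 2 - z) * (G *+ 2 - z) + (8 + 4 * l)%:B * G).
    by rewrite LE; ncring.
  by apply: posD => //; exact: posD.
(* Since [z^2 + z f = l z], adding [z f] to [p4] turns the quadratic estimate into one linear in
   [z]. *)
have p5 : pos (z * f).
  apply: pos_mul => //; apply/eqP; rewrite -subr_eq0; apply/eqP.
  have -> : z * f - f * z = l%:B * f - f * l%:B by rewrite /z; ncring.
  by rewrite scalC subrr.
pose r := 8 + l; have r0 : 0 < r by rewrite ltr_wpDr.
have p6 : pos (r%:B * z - (8 * (l - N))%:B).
  have -> : r%:B * z - (8 * (l - N))%:B = (8 * N)%:B - 8 * f + z * z + z * f.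
    have -> : z * f = z * l%:B - z * z by rewrite /z; ncring.
    rewrite /r -(scalC l z) (rmorphM scal 8 (l - N)) (rmorphM scal 8 N).
    rewrite rmorphB rmorphD !rmorph_nat.
    have -> : f = l%:B - z by rewrite /z; ncring.
    by ncring.
  exact: posD.
(* Dividing [p6] by [r] gives [f <= t], and [t < l] when [N < l]; this contradicts [nrm f = l]. *)
pose t := l - 8 * (l - N) / r.
have p7 : pos (t%:B - f).
  have -> : t%:B - f = (r^-1)%:B * (r%:B * z - (8 * (l - N))%:B).
    rewrite mulrBr mulrA -!rmorphM mulVf ?gt_eqF// rmorph1 mul1r.
    by rewrite /t /z [r^-1 * _]mulrC rmorphB; ncring.
  by apply: posZ p6; rewrite invr_ge0 ltW.
have t0 : 0 <= t.
  by rewrite subr_ge0 ler_pdivrMr// /r; nra.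
have : nrm f <= t by apply: nrm_le_pos => //; apply: posD => //; exact: pos_scal.
rewrite nf leNgt => /negP; apply.
by rewrite /t gtrDl oppr_lt0 divr_gt0// mulr_gt0// subr_gt0.
Qed.

End Symmetries.

(* [e] is the range projection of [q]; [b], [bi] and [c] are the operators B, its
   inverse and the inverse of B (B + I) on the range of [q], extended by 0. *)
Lemma nrm_sub_matched (p q e m b bi c d : B) : p^! = p -> p * p = p ->
  e^! = e -> e * e = e -> e * q = q -> q * e = e ->
  b = d^! * d -> e * b = b -> e * bi = bi -> e * c = c ->
  b * b = (q - e) * (q - e)^! + e -> b * bi = e -> bi * b = e ->
  b * (b + e) * c = e -> c * (b * (b + e)) = e ->
  m + m = (b + e) * bi + bi * (q - e) + (q - e)^! * bi + (q - e)^! * c * (q - e) ->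
  nrm (p - m) <= nrm (p - q).
Proof.
move=> sp pp se ee eq qe bE eb ebi ec; set a := q - e => bb bbi bib bc cb mE.
have qE : q = e + a by rewrite /a addrC subrK.
have ea : e * a = a by rewrite /a mulrBr eq ee.
have ae : a * e = 0 by rewrite /a mulrBl qe ee subrr.
have aa : a * a = 0 by rewrite -{2}ea mulrA ae mul0r.
have eas : e * a^! = 0 by rewrite -se -starM ae star0.
have sb : b^! = b by rewrite bE starM starK.
have be : b * e = b by rewrite -{1}sb -{1}se -starM eb sb.
have bie : bi * e = bi by rewrite -bbi mulrA bib.
have ce : c * e = c by rewrite -bc mulrA cb.
have ab : a * b = 0 by rewrite -eb mulrA ae mul0r.
have bas : b * a^! = 0 by rewrite -sb -starM ab star0.
have aas : a * a^! = b * b - e by rewrite bb addrK.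
have bebC : b * (b + e) = (b + e) * b by rewrite mulrDr mulrDl be eb.
have cbC : c * b = b * c.
  have -> : c * b = c * b * (b * (b + e) * c) by rewrite bc -mulrA be.
  by rewrite bebC !mulrA -(mulrA c b) cb eb.
(* [r] is the inverse of [b + e] in the corner cut out by [e]. *)
pose r := c * b.
have rb : r * (b + e) = e by rewrite /r -mulrA.
have br : (b + e) * r = e by rewrite /r cbC mulrA -bebC.
have sbe : (b + e)^! = b + e by rewrite starD sb se.
have er : e * r = r by rewrite /r mulrA ec.
have sr : r^! = r.
  have sre : r^! * e = r^! by rewrite -{2}er starM se.
  have srb : r^! * (b + e) = e by rewrite -sbe -starM br.
  by rewrite -sre -[X in _ * X = _]br mulrA srb er.
have sc : c^! = c.
  have sce : c^! * e = c^! by rewrite -{2}ec starM se.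
  have h : c^! * (b * (b + e)) = e.
    by have := congr1 star bc; rewrite !starM sbe sb se -bebC.
  by rewrite -sce -[X in _ * X = _]bc mulrA h ec.
have ebe : e * (b + e) = b + e by rewrite mulrDr ee eb.
have bec : (b + e) * c = bi.
  have -> : bi = bi * (b * (b + e) * c) by rewrite bc bie.
  by rewrite !mulrA bib ebe.
have cbe : c * (b + e) = bi by rewrite mulrDr cbC ce -bec mulrDl ec.
have sbi : bi^! = bi by rewrite -{1}bec starM sc sbe cbe.
(* The block matrix factors: [2 m = w c w^*], where [w] is its column with entries [B + I] and
   [A^*]. As [w^* w = 2 b (b + e)] and [c] inverts [b (b + e)], [m] is self-adjoint and
   [(2 m)^2 = 4 m]. *)
pose w := b + e + a^!.
have sw : w^! = b + e + a by rewrite starD sbe starK.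
have mw : m *+ 2 = w * c * w^!.
  have -> : w * c * w^! = (b + e) * (c * (b + e)) + (b + e) * c * a
      + a^! * (c * (b + e)) + a^! * c * a by rewrite sw /w; ncring.
  by rewrite cbe bec mulr2n mE.
have ww : w^! * w = b * (b + e) *+ 2.
  have -> : w^! * w = b * b + b * e + e * b + e * e + (b * a^! + e * a^!)
      + (a * b + a * e) + a * a^! by rewrite sw /w; ncring.
  by rewrite mulrDr be eb ee bas eas ab ae aas !addr0; ncring.
have m4 : m *+ 2 * (m *+ 2) = m *+ 4.
  have -> : m *+ 2 * (m *+ 2) = w * (c * (w^! * w) * c) * w^! by rewrite mw !mulrA.
  rewrite ww mulrnAr cb mulrnAl ec mulrnAr mulrnAl -mw.
  by rewrite -mulrnA.
have sm : m^! = m.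
  rewrite -[m]half2 starM star_scal -scalC -mulr2n mw; congr (_ * _).
  by rewrite !starM starK sc mulrA.
pose V := m *+ 2 - 1; pose S := q *+ 2 - 1; pose U := p *+ 2 - 1.
have s2 x : x^! = x -> (x *+ 2 - 1)^! = x *+ 2 - 1.
  by move=> sx; rewrite starB star1 mulr2n starD sx.
have i2 x : x * x = x -> (x *+ 2 - 1) * (x *+ 2 - 1) = 1.
  move=> xx; have -> : (x *+ 2 - 1) * (x *+ 2 - 1) = (x * x) *+ 4 - x *+ 4 + 1 by ncring.
  by rewrite xx subrr add0r.
have qq : q * q = q by rewrite -{2}eq mulrA qe.
have VV : V * V = 1.
  have -> : V * V = m *+ 2 * (m *+ 2) - m *+ 4 + 1 by rewrite /V; ncring.
  by rewrite m4 subrr add0r.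
have wq : w^! * q = (b + e) * q.
  have -> : w^! * q = (b + e) * q + (a * e + a * a) by rewrite sw qE; ncring.
  by rewrite ae aa !addr0.
have qw : q * w = b * (b + e).
  have -> : q * w = e * (b + e) + e * a^! + (a * b + a * e) + a * a^!
    by rewrite qE /w; ncring.
  by rewrite ebe eas ab ae aas !addr0 mulrDr be addrACA subrr addr0 addrC.
(* This shows that [V q] is self-adjoint, that is [V q = q^* V], which is the relation
   [V S = S^* V]. *)
have Vq : V * q = q^! * bi * q.
  have -> : V * q = m *+ 2 * q - q by rewrite /V mulrBl mul1r.
  rewrite mw -mulrA wq mulrA -(mulrA w) cbe.
  have -> : w * bi = q^! * bi + e.
    by rewrite /w qE starD se !mulrDl bbi ebi; ncring.
  by rewrite mulrDl eq addrK.
have qV : q * V = b.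
  have -> : q * V = q * (m *+ 2) - q by rewrite /V mulrBr mulr1.
  by rewrite mw !mulrA qw bc sw mulrDr ebe ea /a; ncring.
have sV : V^! = V by exact: s2.
have VS : V * S = S^! * V.
  have qVs : q^! * V = V * q.
    by rewrite Vq -[RHS]mulrA; rewrite -{1}sV -starM Vq !starM starK sbi mulrA.
  have -> : S^! = q^! *+ 2 - 1 by rewrite /S starB star1 mulr2n starD.
  have -> : V * S = V * q *+ 2 - V by rewrite /S; ncring.
  by rewrite -qVs; ncring.
(* It reduces [D >= 2] to [b >= e] and [r >= 0]. The term [r] arises from the partial fractions
   [r = bi - c]. *)
have DE : V * S + S * V - 2 = (b - e + a^! * r * a) *+ 2.
  have -> : V * S + S * V - 2 = (V * q + q * V - m *+ 2) *+ 2.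
    by rewrite /S /V; ncring.
  rewrite Vq qV; congr (_ *+ 2).
  have -> : m *+ 2 = e + bi + bi * a + a^! * bi + a^! * c * a.
    by rewrite mulr2n mE mulrDl bbi ebi.
  have -> : q^! * bi * q = e * bi * e + e * bi * a + a^! * (bi * e) + a^! * bi * a.
    by rewrite qE starD se; ncring.
  have -> : r = bi - c by rewrite /r -cbe mulrDr ce addrK.
  by rewrite ebi bie; ncring.
have pee x : pos (x^! * x) by exact: pos_starM.
have pb : pos b by rewrite bE.
have pe : pos e by rewrite -ee -{1}se.
have pr : pos r.
  have -> : r = r^! * (b + e) * r by rewrite sr rb er.
  by apply: pos_conj; exact: posD.
have pbe : pos (b - e).
  have paas : pos (a * a^!) by rewrite -{1}(starK a).
  (* From [(b + e) (b - e) = b^2 - e = a a^*], multiply by [b + e] on the right and cancel with [r]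
     on both sides. The product [b (a a^* )] is positive because its factors commute. *)
  have -> : b - e = r^! * (b * (a * a^!) + a * a^!) * r.
    have -> : b * (a * a^!) + a * a^! = (b + e) * (b - e) * (b + e).
      rewrite aas; have -> : (b + e) * (b - e) * (b + e) =
        b * (b * b) + b * b * e - b * e * b - b * e * e
        + e * b * b + e * b * e - e * e * b - e * e * e by ncring.
      by rewrite mulrBr -(mulrA b b e) !(be, eb, ee); ncring.
    have -> : r^! * ((b + e) * (b - e) * (b + e)) * r =
        r * (b + e) * (b - e) * ((b + e) * r) by rewrite sr; ncring.
    by rewrite rb br mulrBr eb ee mulrBl be ee.
  apply: pos_conj; apply: posD => //; apply: pos_mul => //.
  by rewrite aas mulrBr mulrBl be eb mulrA.
have pD : pos (V * S + S * V - 2).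
  by rewrite DE mulr2n; apply: posD; apply: posD => //; apply: pos_conj.
have := nrm_sub_symmetry (s2 _ sp) sV (i2 _ pp) VV (i2 _ qq) VS pD.
have E x : p *+ 2 - 1 - (x *+ 2 - 1) = 2%:B * (p - x) by rewrite rmorph_nat; ncring.
by rewrite /V /S !E !(nrmZ CB) ger0_norm// ler_pM2l.
Qed.

End Positivity.

(** * Real-valued norms and geometric convergence *)

Section RealNorm.
Context {R : realType} {V : normedModType R[i]}.
Implicit Types x y : V.

Definition rnorm x : R := complex.Re `|x|.

Lemma rnormE x : `|x| = (rnorm x)%:C%C.
Proof. by rewrite RRe_real// normr_real. Qed.

Lemma rnorm_ge0 x : 0 <= rnorm x.
Proof. by rewrite -lecR -rnormE; exact: normr_ge0. Qed.

Lemma rnormD x y : rnorm (x + y) <= rnorm x + rnorm y.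
Proof. by rewrite -lecR rmorphD /= -!rnormE ler_normD. Qed.

Lemma rnormN x : rnorm (- x) = rnorm x.
Proof. by rewrite /rnorm normrN. Qed.

Lemma rnormZ (k : R[i]) x : rnorm (k *: x) = complex.Re `|k| * rnorm x.
Proof.
apply: (@complexI R); rewrite -[LHS]rnormE normrZ rnormE rmorphM; congr (_ * _).
Qed.

Lemma rnormZR (t : R) x : rnorm (t%:C%C *: x) = `|t| * rnorm x.
Proof. by rewrite rnormZ normc_def /= expr0n addr0 sqrtr_sqr. Qed.

Lemma rnorm_double x : rnorm (x + x) = 2 * rnorm x.
Proof.
apply: (@complexI R); rewrite -[LHS]rnormE -mulr2n normrMn rnormE -rmorphMn.
by rewrite mulr_natl.
Qed.

Lemma rnorm0 : rnorm 0 = 0.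
Proof. by rewrite /rnorm normr0. Qed.

Lemma rnorm0_eq0 x : rnorm x = 0 -> x = 0.
Proof. by move=> x0; apply/normr0_eq0; rewrite rnormE x0. Qed.

End RealNorm.

Section Completeness.
Context {R : realType} {V : completeNormedModType R[i]}.

(** The constant is the sum of the geometric series of ratio [1/3]; the rate is what the gliding
    hump argument consumes. *)
Lemma geometric_limit (y : nat -> V) :
  (forall n, rnorm (y n.+1 - y n) <= 3^-1 ^+ n) ->
  exists l, forall n, rnorm (l - y n) <= 3 / 2 * 3^-1 ^+ n.
Proof.
move=> yy.
have dist n k : rnorm (y (k + n)%N - y n) <= 3 / 2 * 3^-1 ^+ n.
  suff : rnorm (y (k + n)%N - y n) <= 3 / 2 * (3^-1 ^+ n - 3^-1 ^+ (k + n)).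
    have : 0 <= 3^-1 ^+ (k + n) :> R by rewrite exprn_ge0.
    by move: (rnorm _) (3^-1 ^+ _) (3^-1 ^+ _) => *; lra.
  elim: k => [|k IH]; first by rewrite !subrr rnorm0 mulr0.
  rewrite addSn -(subrK (y (k + n)%N) (y _)) -addrA.
  apply: le_trans (rnormD _ _) _; apply: le_trans (lerD (yy _) IH) _.
  by rewrite exprS; lra.
have [l yl] : exists l : V, (y x @[x --> \oo]) --> l.
  suff : cauchy_ex (y @ \oo) by move=> /cauchy_exP/cauchy_cvg/cvg_ex.
  move=> e e0.
  have eR : e = (complex.Re e)%:C%C by rewrite RRe_real// gtr0_real.
  have e0' : 0 < complex.Re e by rewrite -ltcR -eR.
  have [n _ hn] : \forall n \near \oo, `|3^-1 ^+ n : R| < complex.Re e / 2.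
    have /cvgr0Pnorm_lt : (3^-1 : R) ^+ n @[n --> \oo] --> 0.
      by apply: cvg_expr; rewrite ger0_norm// invf_lt1 ?ltr1n.
    by apply; rewrite divr_gt0.
  exists (y n); exists n => // m nm.
  rewrite -ball_normE /ball_/= -normrN opprB rnormE eR ltcR.
  rewrite -(subnK nm); apply: le_lt_trans (dist _ _) _.
  have := hn n (leqnn n); have := ler_norm (3^-1 ^+ n : R).
  by set q := 3^-1 ^+ n; lra.
exists l => n; apply/ler_addgt0Pr => e e0.
have /cvgrPdist_lt/(_ e%:C%C) := yl; rewrite ltcR => /(_ e0)[m _ hm].
have := hm (m + n)%N (leq_addr _ _); rewrite rnormE ltcR => he.
rewrite -(subrK (y (m + n)%N) l) -addrA addrC.
apply: le_trans (rnormD _ _) _; apply: lerD; [exact: dist | exact: ltW].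
Qed.

End Completeness.

(** * The ring of adjointable operators *)

Section AdjointableRing.
Context {R : realType} {A : cstarAlgType R} {K : hilbertModType A}.
Implicit Types S T : 'L(K).

(** Definiteness of the inner product makes the adjoint unique, so pointwise equality is equality of
    records. The ring laws can then be Leibniz equalities. *)
Lemma adjointable_eq S T : S =1 T -> S = T.
Proof.
case: S T => [s sa sP] [t ta tP] /= /funext st; subst t.
have E : sa = ta by apply/funext => y; apply: ip_ext => x; rewrite -sP -tP.
by subst ta; congr Adjointable; exact: Prop_irrelevance.
Qed.

Lemma aopD T x y : T (x + y) = T x + T y.
Proof. by have := aop_linear T 1 x y; rewrite !scale1r. Qed.

Lemma aopZ T (k : R[i]) x : T (k *: x) = k *: T x.
Proof. by have := aop_linear T k x 0; rewrite !addr0 aop0 addr0. Qed.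

Fact zero_subproof (x y : K) : ip (0 : K) y = ip x (0 : K) :> A.
Proof. by rewrite ipr0 -ip_star ipr0 -(scale0r 0) cstarZ rmorph0 !scale0r. Qed.

Definition zeroop : 'L(K) := Adjointable zero_subproof.

HB.instance Definition _ := gen_eqMixin 'L(K).
HB.instance Definition _ := gen_choiceMixin 'L(K).

Fact addopA : associative (@addop R A K K).
Proof. by move=> S T U; apply: adjointable_eq => x /=; rewrite addrA. Qed.
Fact addopC : commutative (@addop R A K K).
Proof. by move=> S T; apply: adjointable_eq => x /=; rewrite addrC. Qed.
Fact add0op : left_id zeroop (@addop R A K K).
Proof. by move=> S; apply: adjointable_eq => x /=; rewrite add0r. Qed.
Fact addNop : left_inverse zeroop (subop zeroop) (@addop R A K K).
Proof. by move=> S; apply: adjointable_eq => x /=; rewrite sub0r addNr. Qed.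

HB.instance Definition _ :=
  GRing.isZmodule.Build 'L(K) addopA addopC add0op addNop.

Fact compopA : associative (fun S T : 'L(K) => compop S T).
Proof. by move=> S T U; apply: adjointable_eq. Qed.
Fact comp1op : left_id (idop K) (fun S T : 'L(K) => compop S T).
Proof. by move=> S; apply: adjointable_eq. Qed.
Fact compop1 : right_id (idop K) (fun S T : 'L(K) => compop S T).
Proof. by move=> S; apply: adjointable_eq. Qed.
Fact compopDl : left_distributive (fun S T : 'L(K) => compop S T) +%R.
Proof. by move=> S T U; apply: adjointable_eq. Qed.
Fact compopDr : right_distributive (fun S T : 'L(K) => compop S T) +%R.
Proof. by move=> S T U; apply: adjointable_eq => x /=; rewrite aopD. Qed.

HB.instance Definition _ :=
  GRing.Zmodule_isPzRing.Build 'L(K) compopA comp1op compop1 compopDl compopDr.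

Definition scalop (t : R) : 'L(K) := scaleop t%:C%C (idop K).

Fact scalop_is_additive : zmod_morphism scalop.
Proof.
move=> s t; apply: adjointable_eq => x /=.
by rewrite sub0r rmorphB scalerBl.
Qed.
Fact scalop_is_multiplicative : monoid_morphism scalop.
Proof.
split=> [|s t]; apply: adjointable_eq => x /=; first by rewrite scale1r.
by rewrite rmorphM scalerA.
Qed.
HB.instance Definition _ :=
  GRing.isZmodMorphism.Build R 'L(K) scalop scalop_is_additive.
HB.instance Definition _ :=
  GRing.isMonoidMorphism.Build R 'L(K) scalop scalop_is_multiplicative.

Definition imagop : 'L(K) := scaleop 'i%C (idop K).

Lemma subopE S T : subop S T = S - T.
Proof. by apply: adjointable_eq => x /=; rewrite sub0r. Qed.

End AdjointableRing.

Lemma rnorm_ip (R : realType) (A : cstarAlgType R) (K : hilbertModType A) (x : K) :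
  rnorm (ip x x : A) = rnorm x ^+ 2.
Proof. by apply: (@complexI R); rewrite -[LHS]rnormE -hnormE rnormE -rmorphXn. Qed.

(** * Boundedness and the C*-identity, given Cauchy-Schwarz *)

Section OperatorNorm.
Context {R : realType} {A : cstarAlgType R} {K : hilbertModType A}.
(** Cauchy-Schwarz is left as a hypothesis because these results serve twice: for [A] as a module
    over itself, where it is direct, and for a general module, whose Cauchy-Schwarz inequality rests
    on the first case. *)
Hypothesis CS : forall x y : K, rnorm (ip x y : A) <= rnorm x * rnorm y.
Implicit Types S T : 'L(K).

(** Let [w] be the multiple of [T u] of norm [q]. The pairings of [T u] with [y + w] and [y - w]
    differ by [2 <T u, w>], so one of them has norm at least [q |T u|]. *)
Let gliding_hump_step T (u y : K) (q : R) : 0 < q ->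
  exists y', rnorm (y' - y) <= q /\ q * rnorm (T u) <= rnorm (ip (T u) y' : A).
Proof.
move=> q0; move: (T u) => t; have := rnorm_ge0 t; rewrite le0r => /predU1P[->|t0].
  by exists y; rewrite subrr rnorm0 mulr0 rnorm_ge0 ltW.
pose w := (q / rnorm t)%:C%C *: t.
have q1 : 0 < q / rnorm t by rewrite divr_gt0.
have wq : rnorm w = q by rewrite rnormZR gtr0_norm// mulfVK// gt_eqF.
have bq : rnorm (ip t w : A) = q * rnorm t.
  by rewrite ipZr rnormZR gtr0_norm// rnorm_ip expr2 mulrA mulfVK// gt_eqF.
have : rnorm (ip t w : A) <= rnorm (ip t (y + w) : A) \/
       rnorm (ip t w : A) <= rnorm (ip t (y - w) : A).
  have : 2 * rnorm (ip t w : A) <= rnorm (ip t (y + w) : A) + rnorm (ip t (y - w) : A).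
    have -> : 2 * rnorm (ip t w : A) = rnorm (ip t (y + w) - ip t (y - w) : A).
      rewrite !ipDr ipNr opprB addrC addrA subrK.
      by rewrite rnorm_double.
    by apply: le_trans (rnormD _ _) _; rewrite rnormN.
  by case: (leP (rnorm (ip t w : A)) (rnorm (ip t (y + w) : A))) => ? ?;
     [left | right; lra].
by rewrite bq => -[h|h]; [exists (y + w) | exists (y - w)]; split=> //;
  rewrite addrAC subrr add0r ?rnormN wq.
Qed.

(* Gliding hump along the directions [T (u n)], where [|T (u n)| >= n 3^n]. *)
Lemma aop_bounded T : exists M, 0 <= M /\ forall x, rnorm (T x) <= M * rnorm x.
Proof.
apply: contrapT => nb.
have unb (M : R) : exists u, rnorm u <= 1 /\ M <= rnorm (T u).
  apply: contrapT => Hn; apply: nb; exists (Num.max M 0).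
  split=> [|x]; first by rewrite le_max lexx orbT.
  have := rnorm_ge0 x; rewrite le0r => /predU1P[x0|x0].
    by rewrite x0 mulr0 (rnorm0_eq0 x0) aop0 rnorm0.
  rewrite -ler_pdivrMr//; apply: contrapT => /negP; rewrite -ltNge => Mx.
  apply: Hn; exists ((rnorm x)^-1%:C%C *: x).
  rewrite aopZ !rnormZR gtr0_norm ?invr_gt0// mulVf ?gt_eqF//; split=> //.
  by rewrite mulrC; apply: le_trans (ltW Mx); rewrite le_max lexx.
have /choice[u Hu] := fun n : nat => unb (n%:R * 3 ^+ n).
have q0 n : 0 < 3^-1 ^+ n :> R by rewrite exprn_gt0.
have /choice[s Hs] := fun p : nat * K => gliding_hump_step T (u p.1) p.2 (q0 p.1).
pose y := fix y n := if n is m.+1 then s (m, y m) else 0.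
have [l Hl] : exists l, forall n, rnorm (l - y n) <= 3 / 2 * 3^-1 ^+ n.
  by apply: geometric_limit => n; have [] := Hs (n, y n).
(* The moves after hump [n] total at most half its size, so [3^-n |t| / 2 <= |<t, l>| <= |T^* l|].
   But [3^-n |t| >= n], so this [n] is too large. *)
pose n := (Num.truncn (2 * rnorm (aadj T l))).+1.
have nT : 2 * rnorm (aadj T l) < n%:R by rewrite Num.Theory.truncnS_gt.
have [u1 un] := Hu n; have [_ yn] := Hs (n, y n).
rewrite /= -/(y n.+1) in yn; set t := T (u n) in yn un *.
have h1 : rnorm (ip t l : A) <= rnorm (aadj T l).
  rewrite aopP; apply: le_trans (CS _ _) _.
  by rewrite ler_piMl ?rnorm_ge0.
have h2 : rnorm (ip t (y n.+1) : A) <=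
    rnorm (ip t l : A) + rnorm t * (3 / 2 * 3^-1 ^+ n.+1).
  rewrite -(subrK l (y n.+1)) ipDr addrC; apply: le_trans (rnormD _ _) _.
  rewrite lerD2l; apply: le_trans (CS _ _) _; apply: ler_wpM2l; first exact: rnorm_ge0.
  by rewrite -rnormN opprB; exact: Hl.
have h3 : n%:R <= 3^-1 ^+ n * rnorm t.
  by rewrite mulrC exprVn ler_pdivlMr// exprn_gt0.
by move: h2 yn h3 h1 nT; rewrite exprS /=; move: (3^-1 ^+ n) => r; nra.
Qed.

Definition opnrm T : R := fine (opnorm T).

Lemma opnormE T : opnorm T = (opnrm T)%:E.
Proof.
have [M [M0 MT]] := aop_bounded T.
rewrite /opnrm fineK// fin_numE; apply/andP; split.
  rewrite -ltNye; apply: (@lt_le_trans _ _ 0%E) => //; apply: ereal_sup_ubound.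
  by exists 0; rewrite /= ?normr0 // aop0 normr0.
rewrite -ltey; apply: (@le_lt_trans _ _ M%:E); last exact: ltry.
apply: ge_ereal_sup => _ [x x1 <-]; rewrite lee_fin; apply: le_trans (MT x) _.
by rewrite ler_piMr// -lecR -rnormE.
Qed.

Lemma rnorm_aop T x : rnorm (T x) <= opnrm T * rnorm x.
Proof.
have := rnorm_ge0 x; rewrite le0r => /predU1P[x0|x0].
  by rewrite x0 mulr0 (rnorm0_eq0 x0) aop0 rnorm0.
rewrite -ler_pdivrMr// -lee_fin -opnormE; apply: ereal_sup_ubound.
exists ((rnorm x)^-1%:C%C *: x) => /=.
  by rewrite rnormE rnormZR gtr0_norm ?invr_gt0// mulVf// gt_eqF.
by rewrite aopZ -/(rnorm _) rnormZR gtr0_norm ?invr_gt0// mulrC.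
Qed.

Lemma opnrm_le T (M : R) : 0 <= M ->
  (forall x, rnorm (T x) <= M * rnorm x) -> opnrm T <= M.
Proof.
move=> M0 MT; rewrite -lee_fin -opnormE.
apply: ge_ereal_sup => _ [x x1 <-]; rewrite lee_fin; apply: le_trans (MT x) _.
by rewrite ler_piMr// -lecR -rnormE.
Qed.

Lemma opnrm_ge0 T : 0 <= opnrm T.
Proof.
rewrite -lee_fin -opnormE; apply: ereal_sup_ubound.
by exists 0; rewrite /= ?normr0 // aop0 normr0.
Qed.

Lemma cstar_seminorm_opnrm :
  cstar_seminorm (@scalop R A K) imagop (fun T : 'L(K) => adj T) opnrm.
Proof.
split.
- by move=> t T; apply: adjointable_eq => x /=; rewrite aopZ.
- by move=> T; apply: adjointable_eq => x /=; rewrite aopZ.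
- apply: adjointable_eq => x /=.
  by rewrite scalerA -expr2 sqr_i sub0r scaleN1r.
- by move=> T; apply: adjointable_eq.
- by move=> S T; apply: adjointable_eq.
- by move=> S T; apply: adjointable_eq.
- by move=> t; apply: adjointable_eq => x /=; rewrite oppr0.
- by apply: adjointable_eq => x /=; rewrite sub0r -scaleNr; congr (_ *: _); simpc.
- exact: opnrm_ge0.
- move=> S T; apply: opnrm_le => [|x]; first by rewrite addr_ge0 ?opnrm_ge0.
  by apply: le_trans (rnormD _ _) _; rewrite mulrDl lerD ?rnorm_aop.
- move=> S T; apply: opnrm_le => [|x]; first by rewrite mulr_ge0 ?opnrm_ge0.
  apply: le_trans (rnorm_aop S (T x)) _; rewrite -mulrA.
  by rewrite ler_wpM2l ?opnrm_ge0 ?rnorm_aop.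
- have le t T : opnrm (scalop t * T)%R <= `|t| * opnrm T.
    apply: opnrm_le => [|x]; first by rewrite mulr_ge0 ?opnrm_ge0.
    change (rnorm (t%:C%C *: T x) <= `|t| * opnrm T * rnorm x).
    by rewrite rnormZR -mulrA ler_wpM2l// rnorm_aop.
  (* The reverse inequality is the direct one applied to [t^-1]. *)
  move=> t T; apply/le_anti; rewrite le /=.
  have [->|t0] := eqVneq t 0; first by rewrite normr0 mul0r opnrm_ge0.
  have := le t^-1 (scalop t * T)%R.
  rewrite mulrA -rmorphM mulVf// rmorph1 mul1r normfV.
  by rewrite ler_pdivlMl// normr_gt0.
- by apply: opnrm_le => // x; rewrite mul1r.
(* [|T x|^2 = |<x, T^* T x>| <= c |x|^2]. *)
- move=> T; set c := opnrm (adj T * T)%R.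
  have c0 : 0 <= c := opnrm_ge0 _.
  rewrite -(sqr_sqrtr c0) ler_pXn2r ?nnegrE ?sqrtr_ge0 ?opnrm_ge0//.
  apply: opnrm_le => [|x]; first exact: sqrtr_ge0.
  rewrite -(ler_pXn2r (n := 2)) ?nnegrE ?mulr_ge0 ?rnorm_ge0 ?sqrtr_ge0//.
  rewrite exprMn sqr_sqrtr// -rnorm_ip aopP; apply: le_trans (CS _ _) _.
  rewrite expr2 mulrA [leRHS]mulrC ler_wpM2l ?rnorm_ge0//.
  exact: (rnorm_aop (adj T * T)%R).
Qed.

End OperatorNorm.

(** * The algebra [A] acting on itself by left multiplication *)

Section CStarNorm.
Context {R : realType} {A : cstarAlgType R}.
Implicit Types a b : A.

Lemma rnorm_cmul a b : rnorm (cmul a b) <= rnorm a * rnorm b.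
Proof. by rewrite -lecR rmorphM /= -!rnormE cnormM. Qed.

Lemma rnorm_cstarM a : rnorm (cmul (cstar a) a) = rnorm a ^+ 2.
Proof. by apply: (@complexI R); rewrite -[LHS]rnormE cnorm_star rnormE -rmorphXn. Qed.

Lemma rnorm_cstar a : rnorm (cstar a) = rnorm a.
Proof.
suff le b : rnorm b <= rnorm (cstar b) by apply/le_anti; rewrite le -{2}(cstarK a) le.
have := rnorm_cmul (cstar b) b; rewrite rnorm_cstarM.
have := rnorm_ge0 b; rewrite le0r => /predU1P[->|b0]; first by rewrite rnorm_ge0.
by rewrite expr2 ler_pM2r.
Qed.

End CStarNorm.

Definition selfmod (R : realType) (A : cstarAlgType R) : Type := A.

Section SelfModule.
Context {R : realType} {A : cstarAlgType R}.

HB.instance Definition _ := CompleteNormedModule.copy (selfmod A) A.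

Let sact (x : selfmod A) (a : A) : selfmod A := cmul (x : A) a.
Let sip (x y : selfmod A) : A := cmul (cstar (x : A)) (y : A).

Fact sactDl (x y : selfmod A) a : sact (x + y) a = sact x a + sact y a.
Proof. exact: cmulDl. Qed.
Fact sactDr (x : selfmod A) a b : sact x (a + b) = sact x a + sact x b.
Proof. exact: cmulDr. Qed.
Fact sactZl (k : R[i]) (x : selfmod A) a : sact (k *: x) a = k *: sact x a.
Proof. exact: cmulZl. Qed.
Fact sactZr (k : R[i]) (x : selfmod A) a : sact x (k *: a) = k *: sact x a.
Proof. exact: cmulZr. Qed.
Fact sactM (x : selfmod A) a b : sact x (cmul a b) = sact (sact x a) b.
Proof. exact: cmulA. Qed.
Fact sipDr (x y z : selfmod A) : sip x (y + z) = sip x y + sip x z.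
Proof. exact: cmulDr. Qed.
Fact sipZr (k : R[i]) (x y : selfmod A) : sip x (k *: y) = k *: sip x y.
Proof. exact: cmulZr. Qed.
Fact sip_act (x y : selfmod A) a : sip x (sact y a) = cmul (sip x y) a.
Proof. exact: cmulA. Qed.
Fact sip_star (x y : selfmod A) : cstar (sip x y) = sip y x.
Proof. by rewrite /sip cstarM cstarK. Qed.

HB.instance Definition _ := isHermitianModule.Build R A (selfmod A)
  sactDl sactDr sactZl sactZr sactM sipDr sipZr sip_act sip_star.

Fact sip_ge0 (x : selfmod A) : cpositive (ip x x : A).
Proof. by exists x. Qed.
Fact shnormE (x : selfmod A) : `|x| ^+ 2 = `|ip x x : A|.
Proof. by rewrite [RHS]cnorm_star. Qed.

HB.instance Definition _ := isHilbertModule.Build R A (selfmod A) sip_ge0 shnormE.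

Lemma selfmod_CS (x y : selfmod A) : rnorm (ip x y : A) <= rnorm x * rnorm y.
Proof. by apply: le_trans (rnorm_cmul _ _) _; rewrite rnorm_cstar. Qed.

Fact lmul_subproof (a : A) (x y : selfmod A) :
  ip (cmul a x : selfmod A) y = ip x (cmul (cstar a) y : selfmod A) :> A.
Proof.
by rewrite [LHS]/(cmul (cstar (cmul a x)) y) cstarM; exact: esym (cmulA _ _ _).
Qed.

Definition lmul (a : A) : 'L(selfmod A) := Adjointable (lmul_subproof a).

(** [A] may lack a unit, so the operator is tested on [a^*]: the C*-identity gives
    [|a a^*| = |a|^2]. *)
Lemma rnorm_lmul (a : A) : rnorm a <= opnrm (lmul a).
Proof.
have := rnorm_aop selfmod_CS (lmul a) (cstar a : A).
have -> : rnorm (lmul a (cstar a : A)) = rnorm a ^+ 2.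
  by rewrite -rnorm_cstar -rnorm_cstarM cstarK.
rewrite (rnorm_cstar a).
have := rnorm_ge0 a; rewrite le0r => /predU1P[->|a0].
  by rewrite opnrm_ge0//; exact: selfmod_CS.
by rewrite expr2 ler_pM2r.
Qed.

Lemma opnrm_lmul (a : A) : opnrm (lmul a) = rnorm a.
Proof.
apply/le_anti; rewrite rnorm_lmul andbT.
by apply: (opnrm_le selfmod_CS) => [|x]; [exact: rnorm_ge0 | exact: rnorm_cmul].
Qed.

(** The isometric left regular representation places [A] inside a unital ring of operators, where
    Fukamiya's theorem and monotonicity of the norm apply. *)
Lemma rnorm_le_cstarD (a b : A) :
  rnorm (cmul (cstar a) a) <= rnorm (cmul (cstar a) a + cmul (cstar b) b).
Proof.
have CB := cstar_seminorm_opnrm (@selfmod_CS).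
rewrite -!opnrm_lmul.
have E c : lmul (cmul (cstar c) c) = (adj (lmul c) * lmul c)%R.
  by apply: adjointable_eq => x /=; rewrite cmulA.
have -> : lmul (cmul (cstar a) a + cmul (cstar b) b) =
    (lmul (cmul (cstar a) a) + lmul (cmul (cstar b) b))%R.
  by apply: adjointable_eq => x /=; rewrite cmulDl.
rewrite !E; apply: (nrm_le_of_pos_sub CB).
  exact: (pos_starM CB (lmul a)).
by rewrite addrAC subrr add0r; exact: (pos_starM CB (lmul b)).
Qed.

End SelfModule.

(** * Cauchy-Schwarz for Hilbert modules *)

Section CauchySchwarz.
Context {R : realType} {A : cstarAlgType R} {H : hilbertModType A}.
Implicit Types x y : H.

(* <x - y b, x - y b> >= 0 for b = <y, x> / |y|^2, read in norm. *)
Lemma ip_CS x y : rnorm (ip x y : A) <= rnorm x * rnorm y.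
Proof.
have := rnorm_ge0 y; rewrite le0r => /predU1P[y0|y0].
  by rewrite y0 (rnorm0_eq0 y0) ipr0 rnorm0 mulr0.
pose b : A := ip y x; pose k : A := ip y y.
rewrite -rnorm_cstar ip_star -/b.
pose s := (rnorm y ^+ 2)^-1; have s0 : 0 < s by rewrite invr_gt0 exprn_gt0.
pose z := x - s%:C%C *: act y b.
have [d dE] := ip_ge0 z.
(* The factor [2 s] makes [c^* c] cancel the cross terms of [<z, z>], leaving
   [<x, x> + s^2 b^* k b]. Taking norms gives [2 s |b|^2 <= |x|^2 + s |b|^2]. *)
pose c : A := (Num.sqrt (2 * s))%:C%C *: b.
have cc : cmul (cstar c) c = (2 * s)%:C%C *: cmul (cstar b) b.
  rewrite /c cstarZ cmulZl cmulZr scalerA; congr (_ *: _).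
  have -> : conjc (Num.sqrt (2 * s))%:C%C = (Num.sqrt (2 * s))%:C%C.
    by rewrite /= oppr0.
  by rewrite -rmorphM -expr2 sqr_sqrtr// mulr_ge0// ltW.
have sconj : conjc s%:C%C = s%:C%C by rewrite /= oppr0.
have h1 : ip x (act y b) = cmul (cstar b) b :> A.
  by rewrite ip_act /b ip_star.
have h2 : ip (act y b) x = cmul (cstar b) b :> A.
  by rewrite -ip_star h1 cstarM cstarK.
have h3 : ip (act y b) (act y b) = cmul (cmul (cstar b) k) b :> A.
  by rewrite ip_act -ip_star ip_act cstarM ip_star.
have E : cmul (cstar c) c + cmul (cstar d) d =
    ip x x + (s ^+ 2)%:C%C *: cmul (cmul (cstar b) k) b.
  rewrite -dE cc /z ipDr !ipDl !ipNr !ipNl !ipZr !ipZl h1 h2 h3 sconj.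
  rewrite scalerA -rmorphM -expr2 opprK mulr2n mulrDl mul1r rmorphD scalerDl.
  set p := _ *: _; set q := _ *: _.
  rewrite [- p + q]addrC [ip x x - p + _]addrACA -opprD.
  by rewrite [LHS]addrC subrK.
have := rnorm_le_cstarD c d; rewrite E cc rnormZR gtr0_norm ?mulr_gt0//.
rewrite rnorm_cstarM => hle.
have := le_trans hle (rnormD _ _); rewrite rnorm_ip rnormZR ger0_norm ?sqr_ge0//.
have kb : rnorm (cmul (cmul (cstar b) k) b) <= rnorm b ^+ 2 * rnorm y ^+ 2.
  apply: le_trans (rnorm_cmul _ _) _.
  rewrite expr2 mulrAC -(rnorm_ip y) ler_wpM2r ?rnorm_ge0//.
  by apply: le_trans (rnorm_cmul _ _) _; rewrite rnorm_cstar.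
have h4 : s ^+ 2 * rnorm (cmul (cmul (cstar b) k) b) <= s * rnorm b ^+ 2.
  apply: le_trans (ler_wpM2l (sqr_ge0 _) kb) _.
  rewrite [rnorm b ^+ 2 * _]mulrC mulrA expr2 -(mulrA s) mulVf ?mulr1//.
  by rewrite sqrf_eq0 gt_eqF.
move=> h5.
have : s * rnorm b ^+ 2 <= rnorm x ^+ 2 by lra.
rewrite ler_pdivrMl ?exprn_gt0// mulrC -exprMn.
by rewrite ler_pXn2r ?nnegrE ?mulr_ge0 ?rnorm_ge0.
Qed.

End CauchySchwarz.

Lemma adjM (R : realType) (A : cstarAlgType R) (H : hilbertModType A) (S T : 'L(H)) :
  adj (S * T)%R = (adj T * adj S)%R.
Proof. exact: adjointable_eq. Qed.

(** * From operators on the range of [Q] to the ring of operators on [H] *)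

Section MatchedProjection.
Context {R : realType} {A : cstarAlgType R} {H : hilbertModType A}.
Variables (Q : 'L(H)) (PR : range_projection Q).
Let X : hermModType A := subtype_of (ran Q).
Implicit Types S T : 'L(X).

(** Extension by 0 on the orthogonal complement. It respects sums, products and adjoints and sends
    the identity to [PR], so relations on the range become relations in a single ring. *)
Definition ran_ext T : 'L(H) := ((mp PR)^* * T * mp PR)%L.

Lemma ran_extE T h : ran_ext T h = sub_elt (T (mp PR h)).
Proof. by []. Qed.

Lemma mp_sub_elt (x : X) : mp PR (sub_elt x) = x.
Proof. by apply: val_inj; apply: rproj_fix; exact: (sub_eltS x). Qed.

Lemma ran_ext_ext S T : S =1 T -> ran_ext S = ran_ext T.
Proof. by move=> ST; apply: adjointable_eq => h; rewrite !ran_extE ST. Qed.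

Lemma ran_extM S T : ran_ext (S * T)%L = ran_ext S * ran_ext T.
Proof.
apply: adjointable_eq => h.
change (sub_elt (S (T (mp PR h))) = sub_elt (S (mp PR (sub_elt (T (mp PR h)))))).
by rewrite mp_sub_elt.
Qed.

Lemma ran_extD S T : ran_ext (S + T)%L = ran_ext S + ran_ext T.
Proof. exact: adjointable_eq. Qed.

Lemma ran_ext1 : ran_ext (idop X) = PR.
Proof. exact: adjointable_eq. Qed.

Lemma ran_ext_adj T : ran_ext (T^*)%L = adj (ran_ext T).
Proof. exact: adjointable_eq. Qed.

Lemma proj_ran_ext T : (PR : 'L(H)) * ran_ext T = ran_ext T.
Proof.
apply: adjointable_eq => h.
by apply: rproj_fix; exact: (sub_eltS (T (mp PR h))).
Qed.

Lemma projQ : (PR : 'L(H)) * Q = Q.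
Proof. by apply: adjointable_eq => h; apply: rproj_fix; exists h. Qed.

Lemma Qproj : is_idempotent Q -> Q * (PR : 'L(H)) = PR.
Proof.
move=> QQ; apply: adjointable_eq => h; change (Q (PR h) = PR h).
by have [u _ <-] := rproj_ran PR h; exact: QQ.
Qed.

Lemma proj_proj : (PR : 'L(H)) * (PR : 'L(H)) = PR.
Proof. by apply: adjointable_eq; exact: (rproj_proj PR).1. Qed.

Lemma proj_adj : adj PR = PR.
Proof. by apply: adjointable_eq; exact: (rproj_proj PR).2. Qed.

Hypothesis QQ : is_idempotent Q.
Let e : 'L(H) := PR.
Let a : 'L(H) := (Q - e)%R.

Let a1e : a * (1 - e) = a.
Proof. by rewrite mulrBr mulr1 /a mulrBl Qproj// proj_proj subrr subr0. Qed.

Let mA_ext h : sub_elt (mA PR (mq PR h)) = a h.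
Proof.
rewrite mAE -[in RHS]a1e.
(* The opposite in the ring of operators is [subop zeroop], so differences unfold to the form
   [x + (0 - y)]. *)
change (Q (h - PR h) - PR (h - PR h) =
  Q (h + (0 - PR h)) + (0 - PR (h + (0 - PR h)))).
by rewrite !sub0r.
Qed.

Lemma ran_ext_mAmA : ran_ext (mA PR * (mA PR)^*)%L = a * adj a.
Proof.
apply: adjointable_eq => h.
change (sub_elt (mA PR (mq PR (adj (subop Q PR) (PR h)))) = a (adj a h)).
rewrite mA_ext subopE -/e -/a; congr (a _).
have ea : e * a = a by rewrite mulrBr projQ proj_proj.
have /(congr1 (fun T : 'L(H) => T h)) : adj a * e = adj a.
  by rewrite -[in RHS]ea adjM proj_adj.
exact.
Qed.

(** Doubling absorbs the factor [2^-1] and matches the hypothesis on [m + m] in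
    [nrm_sub_matched]. *)
Lemma matched_block_double B Bi Ci :
  matched_block PR B Bi Ci + matched_block PR B Bi Ci =
  (ran_ext B + e) * ran_ext Bi + ran_ext Bi * a + adj a * ran_ext Bi
  + adj a * ran_ext Ci * a.
Proof.
have adj_a x : sub_elt (aadj (mA PR) x) = adj a (sub_elt x).
  change (sub_elt (mq PR (adj (subop Q PR) (sub_elt x))) = adj a (sub_elt x)).
  rewrite subopE -/e -/a.
  have a1eS : (1 - e) * adj a = adj a.
    rewrite -[in RHS]a1e adjM; congr (_ * _).
    by rewrite -subopE; apply: adjointable_eq => z /=; rewrite rproj_adj.
  rewrite -[in RHS]a1eS.
  change (adj a (sub_elt x) - PR (adj a (sub_elt x)) =
    adj a (sub_elt x) + (0 - PR (adj a (sub_elt x)))).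
  by rewrite sub0r.
apply: adjointable_eq => h.
change (matched_block PR B Bi Ci h + matched_block PR B Bi Ci h =
  ran_ext B (ran_ext Bi h) + PR (ran_ext Bi h) + ran_ext Bi (a h)
  + adj a (ran_ext Bi h) + adj a (ran_ext Ci (a h))).
pose x := mp PR h; pose y := mq PR h.
(* The two summands are the components of the value in the range of [Q] and in the null space of
   [Q^*]. *)
change (matched_block PR B Bi Ci h) with
  (2^-1 *: (sub_elt (B (Bi x)) + sub_elt (Bi x) + sub_elt (Bi (mA PR y)))
   + 2^-1 *: (sub_elt (aadj (mA PR) (Bi x)) + sub_elt (aadj (mA PR) (Ci (mA PR y))))).
have d (v : H) : 2^-1 *: v + 2^-1 *: v = v.
  by rewrite -scalerDl -mulr2n -(mulr_natr 2^-1) mulVf ?pnatr_eq0// scale1r.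
rewrite addrACA !d -mA_ext !ran_extE !mp_sub_elt !adj_a -!addrA.
congr (_ + (_ + _)).
by rewrite rproj_fix//; exact: (sub_eltS (Bi x)).
Qed.

End MatchedProjection.

Theorem theorem4p6 (R : realType) (A : cstarAlgType R) (H : hilbertModType A)
    (P Q M : 'L(H)) :
  is_projection P -> is_idempotent Q -> is_matched_projection Q M ->
  (opnorm (P - M)%L <= opnorm (P - Q)%L)%E.
Proof.
move=> [PP PS] QQ MQ.
have CS := @ip_CS R A H.
rewrite !(opnormE CS) lee_fin !subopE.
case: MQ => [[_ /adjointable_eq->]//|[_ [PR [B [Bi [Ci []]]]]]].
move=> [[S BS] BB] [BBi BiB] [BC CB] /adjointable_eq ->.
(* The remaining goals are the relations between [B], [Bi], [Ci] and [A], transported along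
   [ran_ext]. *)
apply: (nrm_sub_matched (cstar_seminorm_opnrm CS) (e := PR) (b := ran_ext PR B)
  (bi := ran_ext PR Bi) (c := ran_ext PR Ci) (d := ran_ext PR S)).
- exact: adjointable_eq.
- exact: adjointable_eq.
- exact: proj_adj.
- exact: proj_proj.
- exact: projQ.
- exact: Qproj.
- by rewrite (ran_ext_ext PR BS) ran_extM ran_ext_adj.
- exact: proj_ran_ext.
- exact: proj_ran_ext.
- exact: proj_ran_ext.
- by rewrite -ran_extM (ran_ext_ext PR BB) ran_extD ran_ext_mAmA// ran_ext1.
- by rewrite -ran_extM (ran_ext_ext PR BBi) ran_ext1.
- by rewrite -ran_extM (ran_ext_ext PR BiB) ran_ext1.
- by rewrite -(ran_ext1 PR) -ran_extD -!ran_extM (ran_ext_ext PR BC).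
- by rewrite -(ran_ext1 PR) -ran_extD -!ran_extM (ran_ext_ext PR CB).
- exact: matched_block_double.
Qed.
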